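(* There exists a Hausdorff locally convex-solid (real) vector lattice $X$ satisfying the generalized (A, 0) property such that, if $(\hat X,J)$ denotes its topological completion, the image $J(X)$ is not a regular sublattice of $\hat X$.
   Context: All vector lattices are real; $X_+$ denotes the positive cone. A locally solid vector lattice is a vector lattice with a linear topology having a base of neighborhoods of zero consisting of solid sets ($U$ is solid if $|x|\le |y|$, $y\in U$ imply $x\in U$); it is locally convex-solid if its topology is in addition locally convex (equivalently, it is generated by a family of lattice seminorms, i.e. seminorms $p$ with $|x|\le|y|\Rightarrow p(x)\le p(y)$). A Hausdorff locally solid vector lattice $X$ has the generalized (A, 0) property if every topologically Cauchy net $(x_\alpha)\subseteq X_+$ satisfying $x_\alpha\downarrow 0$ (decreasing with infimum $0$ in $X$) also satisfies $x_\alpha\to 0$ in the topology. A vector sublattice $Y$ of a vector lattice $Z$ is regular in $Z$ if suprema and infima computed in $Y$ are preserved in $Z$; equivalently, every subset of $Y_+$ whose infimum in $Y$ is $0$ also has infimum $0$ in $Z$. Topological completion: for a Hausdorff locally solid vector lattice $X$, its topological completion is the pair $(\hat X, J)$, unique up to isomorphism, where $\hat X$ is a complete (every Cauchy net converges) Hausdorff topological vector space and $J\colon X\to\hat X$ is a linear topological embedding with dense range; $\hat X$ is ordered by taking as positive cone the closure of $J(X_+)$, which makes $\hat X$ a Hausdorff locally solid vector lattice and $J$ a lattice homomorphism. *)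

(* Defs.v *)
From HB Require Import structures.
From mathcomp Require Import all_boot all_order all_algebra.
From mathcomp Require Import all_classical all_reals all_analysis.

Set Implicit Arguments.
Unset Strict Implicit.
Unset Printing Implicit Defensive.

Import Order.TTheory GRing.Theory Num.Theory.
Import numFieldNormedType.Exports.

Local Open Scope classical_set_scope.
Local Open Scope ring_scope.

(* [Num.POrderedZmodule] is only a partial order on an additive group, with no  *)
(* compatibility axiom. The binary suprema and infima are fields here because  *)
(* HB rejects a join of [Zmodule] with [Order.Lattice] that is declared after  *)
(* the ordered ring structures.                                                *)
HB.mixin Record Lmodule_isVectorLattice (R : numDomainType) V
    & Num.POrderedZmodule V & GRing.Lmodule R V := {
  vlat_leD2r : forall z x y : V, x <= y -> x + z <= y + z ;
  vlat_scale_ge0 : forall (a : R) (x : V), 0 <= a -> 0 <= x -> 0 <= a *: x ;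
  vjoin : V -> V -> V ;
  vmeet : V -> V -> V ;
  vjoin_le : forall x y z : V, (vjoin x y <= z) = (x <= z) && (y <= z) ;
  le_vmeet : forall x y z : V, (z <= vmeet x y) = (z <= x) && (z <= y)
}.

#[short(type="vectorLatticeType")]
HB.structure Definition VectorLattice (R : numDomainType) :=
  {V of Num.POrderedZmodule V & GRing.Lmodule R V
      & Lmodule_isVectorLattice R V}.

Definition vabs (R : numDomainType) (V : vectorLatticeType R) (x : V) : V :=
  vjoin x (- x).

Definition solid (R : numDomainType) (V : vectorLatticeType R) (U : set V) :=
  forall x y : V, vabs x <= vabs y -> U y -> U x.

(* Only the linear topology is recorded, and not a uniform structure: the      *)
(* library's [tvsType] does not tie its uniformity to the addition, so Cauchy  *)
(* nets are defined below directly from neighborhoods of zero.                 *)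
HB.mixin Record TopologicalLmodule_isLocallySolid (R : numDomainType) V
    & TopologicalLmodule R V & VectorLattice R V := {
  locally_solid : forall U : set V, nbhs 0 U ->
    exists S : set V, [/\ nbhs 0 S, solid S & S `<=` U]
}.

#[short(type="locallySolidType")]
HB.structure Definition LocallySolid (R : numDomainType) :=
  {V of TopologicalLmodule R V & VectorLattice R V
      & TopologicalLmodule_isLocallySolid R V}.

(* Convexity axiom of [tvsType], restated on a bare linear topology.           *)
Definition locally_convex_space (R : numDomainType)
    (V : topologicalLmodType R) :=
  exists2 B : set_system V, (forall b, b \in B -> convex_set b) & basis B.

Record directedSet := DirectedSet {
  dsort :> Type ;
  dle : dsort -> dsort -> Prop ;
  dle_refl : forall i, dle i i ;
  dle_trans : forall j i k, dle i j -> dle j k -> dle i k ;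
  dle_directed : forall i j, exists k, dle i k /\ dle j k ;
  d_inhabited : inhabited dsort
}.

Definition tails (I : directedSet) : set_system I :=
  filter_from setT (fun i : I => [set j | dle i j]).
Arguments tails I : clear implicits.

Definition cauchy_net (R : numDomainType) (V : topologicalLmodType R)
    (I : directedSet) (x : I -> V) :=
  forall U : set V, nbhs 0 U ->
    exists i0, forall i j, dle i0 i -> dle i0 j -> U (x i - x j).

Definition complete_space (R : numDomainType) (V : topologicalLmodType R) :=
  forall (I : directedSet) (x : I -> V), cauchy_net x ->
    exists l : V, x @ tails I --> l.

Definition decreases_to_zero (R : numDomainType) (V : vectorLatticeType R)
    (I : directedSet) (x : I -> V) :=
  (forall i j, dle i j -> x j <= x i) /\ infimums (range x) 0.

Definition generalized_A0 (R : numDomainType) (V : locallySolidType R) :=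
  forall (I : directedSet) (x : I -> V),
    (forall i, 0 <= x i) -> cauchy_net x -> decreases_to_zero x ->
    x @ tails I --> (0 : V).

Definition topological_embedding (X Y : topologicalType) (f : X -> Y) :=
  injective f /\
  forall A : set X, open A <-> exists2 B : set Y, open B & f @^-1` B = A.

(* By [completion_cone] the order of [Xh] is the one induced by the closure of *)
(* [J] applied to the positive cone of [X]. That [Xh] is then a locally solid  *)
(* vector lattice and that [J] preserves joins and meets follow from the other *)
(* clauses; they are recorded so that [range J] is a vector sublattice, and a  *)
(* failure of [regular_sublattice (range J)] is one of preserving bounds.      *)
Record is_completion (R : numDomainType) (X Xh : locallySolidType R)
    (J : {linear X -> Xh}) : Prop := IsCompletion {
  completion_hausdorff : hausdorff_space Xh ;
  completion_complete : complete_space Xh ;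
  completion_embedding : topological_embedding J ;
  completion_dense : dense (range J) ;
  completion_cone :
    [set z : Xh | 0 <= z] = closure (J @` [set x : X | 0 <= x]) ;
  completion_join : {morph J : x y / vjoin x y} ;
  completion_meet : {morph J : x y / vmeet x y}
}.

(* Bounds computed inside the subset [Y] of [T].                               *)
Definition supremums_in (d : Order.disp_t) (T : porderType d)
    (Y A : set T) : set T :=
  [set s | [/\ Y s, ubound A s & forall t, Y t -> ubound A t -> (s <= t)%O]].

Definition infimums_in (d : Order.disp_t) (T : porderType d)
    (Y A : set T) : set T :=
  [set s | [/\ Y s, lbound A s & forall t, Y t -> lbound A t -> (t <= s)%O]].

Definition vector_sublattice (R : numDomainType) (Z : vectorLatticeType R)
    (Y : set Z) :=
  [/\ Y 0,
      forall (a : R) x y, Y x -> Y y -> Y (a *: x + y),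
      forall x y, Y x -> Y y -> Y (vjoin x y)
    & forall x y, Y x -> Y y -> Y (vmeet x y)].

Definition regular_sublattice (R : numDomainType) (Z : vectorLatticeType R)
    (Y : set Z) :=
  vector_sublattice Y /\
  forall A : set Z, A !=set0 -> A `<=` Y ->
    supremums_in Y A `<=` supremums A /\ infimums_in Y A `<=` infimums A.

(* Main.v *)
Require Import Defs.
From HB Require Import structures.
From mathcomp Require Import all_boot all_order all_algebra.
From mathcomp Require Import all_classical all_reals all_analysis.
From mathcomp Require Import zify lra.

Set Implicit Arguments.
Unset Strict Implicit.
Unset Printing Implicit Defensive.

Import Order.TTheory GRing.Theory Num.Theory.
Import numFieldNormedType.Exports.

Local Open Scope classical_set_scope.
Local Open Scope ring_scope.

(** Write Z2 for the 2-adic integers. The space X consists of the step functions on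
    Z2, seen as functions on nat with a period 2 ^ n. Its topology combines the
    mean of |f|, which is the L1 norm for the Haar measure of Z2, with the suprema
    of |f| over the negligible sets, those that step functions of arbitrarily
    small mean cover.

    The generalized (A, 0) property comes from the second family. The range of a
    2-adically convergent sequence is negligible, so a decreasing Cauchy net of X
    converges uniformly along such sequences and its limit is continuous on Z2. A
    continuous limit that is positive somewhere is bounded below by a positive
    constant on a residue class, which contradicts an infimum equal to 0
    ([decreasing_pointwise_zero]); and a decreasing net with pointwise limit 0
    tends to 0 uniformly, by the compactness of Z2 ([decreasing_uniform_zero]).

    Regularity fails because the two families are independent: subtracting a
    cover of small mean makes a function vanish on a negligible set at almost no
    cost in L1, so the completion contains elements that are nonzero for the
    L1 norm alone. Let C be a closed subset of Z2 of positive measure that contains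
    no natural number, obtained by removing a small class around each of them. The
    indicators [punctured n] of the successive stages decrease to 0 pointwise on
    nat, hence have infimum 0 in X. Cutting them down on larger and larger
    negligible sets gives a Cauchy net ([cauchy_net_below_punctured]) whose limit
    in any completion is the indicator of C for the L1 norm and 0 for the suprema. This
    limit is a positive nonzero lower bound of all the [punctured n]. Such a net
    cannot be monotone, since the generalized (A, 0) property holds.

    The existence of a completion is proved for every Hausdorff locally solid
    vector lattice X: its points are the Cauchy nets of X indexed by the solid
    neighborhoods of zero, modulo null nets ([completion_exists]). *)

(** * Vector lattices *)

Section VectorLatticeTheory.
Context {R : realType} {V : vectorLatticeType R}.
Implicit Types x y z : V.

Lemma vleD2r z x y : (x + z <= y + z) = (x <= y).
Proof.
apply/idP/idP => [/(vlat_leD2r (- z))|]; last exact: vlat_leD2r.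
by rewrite !addrK.
Qed.

Lemma vleD2l z x y : (z + x <= z + y) = (x <= y).
Proof. by rewrite ![z + _]addrC vleD2r. Qed.

Lemma vsub_ge0 x y : (0 <= y - x) = (x <= y).
Proof. by rewrite -(vleD2r x 0) add0r subrK. Qed.

Lemma vleN2 x y : (- x <= - y) = (y <= x).
Proof. by rewrite -(vsub_ge0 (- x)) opprK addrC vsub_ge0. Qed.

Lemma vleD x y z t : x <= y -> z <= t -> x + z <= y + t.
Proof.
by move=> xy zt; apply: (@le_trans _ _ (y + z)); rewrite ?vleD2r ?vleD2l.
Qed.

Lemma vle_scale (a : R) x y : 0 <= a -> x <= y -> a *: x <= a *: y.
Proof.
move=> a0; rewrite -(vsub_ge0 x) -(vsub_ge0 (a *: x)) -scalerBr.
exact: vlat_scale_ge0.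
Qed.

Lemma vle_joinl x y : x <= vjoin x y.
Proof. by have := vjoin_le x y (vjoin x y); rewrite lexx => /esym/andP[]. Qed.

Lemma vle_joinr x y : y <= vjoin x y.
Proof. by have := vjoin_le x y (vjoin x y); rewrite lexx => /esym/andP[]. Qed.

Lemma vjoin_lub x y z : x <= z -> y <= z -> vjoin x y <= z.
Proof. by move=> xz yz; rewrite vjoin_le xz yz. Qed.

Lemma vjoinC x y : vjoin x y = vjoin y x.
Proof. by apply/le_anti; rewrite !vjoin_lub ?vle_joinl ?vle_joinr. Qed.

Lemma vjoinA x y z : vjoin x (vjoin y z) = vjoin (vjoin x y) z.
Proof.
apply/le_anti; rewrite !vjoin_le vle_joinr vle_joinl.
rewrite !(le_trans (vle_joinl _ _) (vle_joinl _ _)).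
rewrite !(le_trans (vle_joinr _ _) (vle_joinl _ _)).
rewrite !(le_trans (vle_joinl _ _) (vle_joinr _ _)).
by rewrite !(le_trans (vle_joinr _ _) (vle_joinr _ _)).
Qed.

Lemma vjoin_idPr x y : reflect (vjoin x y = y) (x <= y).
Proof.
apply: (iffP idP) => [xy|<-]; last exact: vle_joinl.
by apply/le_anti; rewrite vle_joinr vjoin_lub.
Qed.

Lemma vjoinxx x : vjoin x x = x.
Proof. exact/vjoin_idPr. Qed.

Lemma vjoinDr z x y : vjoin (x + z) (y + z) = vjoin x y + z.
Proof.
apply/le_anti; rewrite vjoin_le !vleD2r vle_joinl vle_joinr/=.
rewrite -(vleD2r (- z)) addrK vjoin_le -(vleD2r z) subrK vle_joinl.
by rewrite -(vleD2r z y) subrK vle_joinr.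
Qed.

Lemma vjoin_scale (a : R) x y : 0 <= a ->
  vjoin (a *: x) (a *: y) = a *: vjoin x y.
Proof.
rewrite le_eqVlt => /predU1P[<-|a0]; first by rewrite !scale0r vjoinxx.
have a0' := ltW a0; have a1 : 0 <= a^-1 by rewrite invr_ge0.
have h (u v : V) : (a *: u <= v) = (u <= a^-1 *: v).
  apply/idP/idP => uv.
    by have := vle_scale a1 uv; rewrite scalerK// gt_eqF.
  by have := vle_scale a0' uv; rewrite scalerKV// gt_eqF.
apply/le_anti; rewrite vjoin_le !vle_scale ?vle_joinl ?vle_joinr//=.
by rewrite h vjoin_le -!h vle_joinl vle_joinr.
Qed.

Lemma vmeetE x y : vmeet x y = x + y - vjoin x y.
Proof.
have h z : (z <= vmeet x y) = (z <= x + y - vjoin x y).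
  transitivity (vjoin x y <= x + y - z); last first.
    by rewrite -[LHS]vsub_ge0 -[RHS]vsub_ge0 addrAC.
  rewrite vjoin_le le_vmeet andbC -[z <= y]vsub_ge0 -[z <= x]vsub_ge0.
  rewrite -[x <= _]vsub_ge0 -[y <= _]vsub_ge0; congr (_ && _); congr (0 <= _).
    by rewrite addrAC [x + y]addrC addrK.
  by rewrite [RHS]addrAC addrK.
by apply/le_anti; rewrite -h lexx h lexx.
Qed.

Lemma vabs_leP x y : reflect (x <= y /\ - x <= y) (vabs x <= y).
Proof. by rewrite /vabs vjoin_le; exact: andP. Qed.

Lemma vabs_ge x : x <= vabs x.
Proof. exact: vle_joinl. Qed.

Lemma vabs_geN x : - x <= vabs x.
Proof. exact: vle_joinr. Qed.

Lemma vabsN x : vabs (- x) = vabs x.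
Proof. by rewrite /vabs opprK vjoinC. Qed.

Lemma vabs_ge0 x : 0 <= vabs x.
Proof.
have : 0 <= vabs x + vabs x by rewrite -(subrr x) vleD ?vabs_ge ?vabs_geN.
rewrite -mulr2n -scaler_nat => /(@vlat_scale_ge0 _ _ (2^-1) _ (ltac:(lra))).
by rewrite scalerA mulVf ?scale1r ?pnatr_eq0.
Qed.

Lemma ger0_vabs x : 0 <= x -> vabs x = x.
Proof.
move=> x0; rewrite /vabs vjoinC; apply/vjoin_idPr/(le_trans _ x0).
by rewrite -oppr0 vleN2.
Qed.

Lemma vabs_id x : vabs (vabs x) = vabs x.
Proof. exact/ger0_vabs/vabs_ge0. Qed.

Lemma vabs0 : vabs 0 = 0 :> V.
Proof. by rewrite /vabs oppr0 vjoinxx. Qed.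

Lemma vabsD x y : vabs (x + y) <= vabs x + vabs y.
Proof. by apply/vabs_leP; rewrite opprD !vleD ?vabs_ge ?vabs_geN. Qed.

Lemma vabs_scale (a : R) x : vabs (a *: x) = `|a| *: vabs x.
Proof.
have h (b : R) (y : V) : 0 <= b -> vabs (b *: y) = b *: vabs y.
  by move=> b0; rewrite /vabs -scalerN vjoin_scale.
have [a0|a0] := ger0P a; first exact: h.
by rewrite -vabsN -scaleNr h// oppr_ge0 ltW.
Qed.

Lemma vabs_scale_le (a : R) x : `|a| <= 1 -> vabs (a *: x) <= vabs x.
Proof.
move=> a1; rewrite vabs_scale -vsub_ge0 -{1}[vabs x]scale1r -scalerBl.
by apply: vlat_scale_ge0 (vabs_ge0 x); rewrite subr_ge0.
Qed.

(** Birkhoff's inequality, which makes the join uniformly continuous for every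
    locally solid topology. *)
Lemma vabs_join x y x' y' :
  vabs (vjoin x y - vjoin x' y') <= vabs (x - x') + vabs (y - y').
Proof.
have h (u v u' v' : V) : vjoin u v - vjoin u' v' <= vabs (u - u') + vabs (v - v').
  rewrite -(vleD2r (vjoin u' v')) subrK; apply: vjoin_lub.
    have := vleD (vleD (vabs_ge (u - u')) (vabs_ge0 (v - v'))) (vle_joinl u' v').
    by rewrite addr0 subrK.
  have := vleD (vleD (vabs_ge0 (u - u')) (vabs_ge (v - v'))) (vle_joinr u' v').
  by rewrite add0r subrK.
by apply/vabs_leP; rewrite opprB h -(vabsN (x - x')) -(vabsN (y - y')) !opprB h.
Qed.

Lemma solid_scale (U : set V) (a : R) x : solid U -> `|a| <= 1 -> U x -> U (a *: x).
Proof. by move=> sU a1; apply: sU; exact: vabs_scale_le. Qed.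

Lemma solidN (U : set V) x : solid U -> U x -> U (- x).
Proof. by move=> sU; apply: sU; rewrite vabsN. Qed.

End VectorLatticeTheory.

(** A vector lattice is determined by its binary join: the order is recovered as
    x \/ y = y, the meet as x + y - x \/ y, and every order axiom becomes an
    equation. Equations survive pointwise definitions and passage to limits,
    which is how both lattices below are obtained. *)
HB.factory Record Lmodule_hasJoin (R : realType) V & GRing.Lmodule R V := {
  join : V -> V -> V ;
  joinC : commutative join ;
  joinA : associative join ;
  joinxx : idempotent_op join ;
  joinDr : forall z x y : V, join (x + z) (y + z) = join x y + z ;
  join_scale : forall (a : R) (x : V), 0 <= a ->
    join 0 (a *: x) = a *: join 0 x
}.

HB.builders Context R V & Lmodule_hasJoin R V.

Let le (x y : V) := join x y == y.

Let le_refl : reflexive le.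
Proof. by move=> x; rewrite /le joinxx. Qed.

Let le_anti : antisymmetric le.
Proof. by move=> x y /andP[/eqP xy /eqP]; rewrite joinC xy. Qed.

Let le_trans : transitive le.
Proof. by move=> y x z /eqP xy /eqP yz; rewrite /le -yz joinA xy. Qed.

HB.instance Definition _ :=
  Order.Le_isPOrder.Build ring_display V le_refl le_anti le_trans.

Let leE (x y : V) : (x <= y) = (join x y == y). Proof. by []. Qed.

Let leD2r (z x y : V) : x <= y -> x + z <= y + z.
Proof. by rewrite !leE joinDr => /eqP->. Qed.

Let scale_ge0 (a : R) (x : V) : 0 <= a -> 0 <= x -> 0 <= a *: x.
Proof. by rewrite !leE => a0 /eqP x0; rewrite join_scale// x0. Qed.

Let join_le (x y z : V) : (join x y <= z) = (x <= z) && (y <= z).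
Proof.
apply/idP/andP => [|[]]; rewrite !leE => /eqP.
  move=> <-; split; rewrite -!joinA.
    by rewrite joinA joinxx.
  by rewrite joinA [join y x]joinC -joinA [join y _]joinA joinxx.
by move=> xz /eqP yz; rewrite -joinA yz xz.
Qed.

Let meet (x y : V) := x + y - join x y.

Let le_meet (x y z : V) : (z <= meet x y) = (z <= x) && (z <= y).
Proof.
have sub_ge0 (u v : V) : (0 <= v - u) = (u <= v).
  apply/idP/idP => [/(leD2r u)|/(leD2r (- u))]; first by rewrite add0r subrK.
  by rewrite subrr.
transitivity (join x y <= x + y - z).
  by rewrite -[LHS]sub_ge0 -[RHS]sub_ge0 addrAC.
rewrite join_le -[z <= y]sub_ge0 -[z <= x]sub_ge0 andbC.
rewrite -[x <= _]sub_ge0 -[y <= _]sub_ge0; congr (_ && _); congr (0 <= _).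
  by rewrite addrAC addrK.
by rewrite addrAC [x + y]addrC addrK.
Qed.

HB.instance Definition _ :=
  Lmodule_isVectorLattice.Build R V leD2r scale_ge0 join_le le_meet.

HB.end.

(** Solidity makes the members of the base symmetric and stable under scalars of
    modulus at most 1, so that a base of zero-neighborhoods of a linear topology
    only has to admit halving and to absorb points. *)
HB.factory Record VectorLattice_hasSolidBase (R : realType) V
    & VectorLattice R V := {
  zbase : set_system V ;
  zbaseT : exists A, zbase A ;
  zbaseI : forall A B, zbase A -> zbase B ->
    exists2 C, zbase C & C `<=` A `&` B ;
  zbase_solid : forall A, zbase A -> solid A ;
  zbaseD : forall A, zbase A ->
    exists2 B, zbase B & forall x y, B x -> B y -> A (x + y) ;
  zbase_absorb : forall A (x : V), zbase A ->
    exists2 a : R, 0 < a & A (a *: x)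
}.

HB.builders Context R V & VectorLattice_hasSolidBase R V.

Let nbhsV (x : V) : set_system V :=
  [set U | exists2 A, zbase A & forall y, A y -> U (x + y)].

HB.instance Definition _ := hasNbhs.Build V nbhsV.

Let nbhsVE (x : V) (U : set V) :
  nbhs x U <-> exists2 A, zbase A & forall y, A y -> U (x + y).
Proof. by []. Qed.

Let zbase0 A : zbase A -> A 0.
Proof.
move=> bA; have [a _ Aa] := zbase_absorb 0 bA.
by move: Aa; rewrite scaler0.
Qed.

Let nbhsV_filter (x : V) : ProperFilter (nbhs x).
Proof.
split; last split.
- by move=> /nbhsVE[A /zbase0 A0 /(_ _ A0)].
- by have [A bA] := zbaseT; apply/nbhsVE; exists A.
- move=> P Q /nbhsVE[A bA AP] /nbhsVE[B bB BQ]; apply/nbhsVE.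
  have [C bC CAB] := zbaseI bA bB.
  by exists C => // y /CAB[Ay By]; split; [exact: AP|exact: BQ].
- move=> P Q PQ /nbhsVE[A bA AP]; apply/nbhsVE.
  by exists A => // y /AP /PQ.
Qed.

Let nbhsV_singleton (x : V) (U : set V) : nbhs x U -> U x.
Proof. by move=> /nbhsVE[A /zbase0 A0 /(_ _ A0)]; rewrite addr0. Qed.

Let nbhsV_nbhs (x : V) (U : set V) : nbhs x U -> nbhs x (nbhs^~ U).
Proof.
move=> /nbhsVE[A bA AU]; have [B bB BA] := zbaseD bA; apply/nbhsVE.
exists B => // y By; apply/nbhsVE; exists B => // z Bz.
by rewrite -addrA; apply/AU/BA.
Qed.

HB.instance Definition _ :=
  Nbhs_isNbhsTopological.Build V nbhsV_filter nbhsV_singleton nbhsV_nbhs.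

Let add_continuous : continuous (fun x : V * V => x.1 + x.2).
Proof.
move=> [x y] U /nbhsVE[A bA /= AU]; have [B bB BA] := zbaseD bA.
exists ([set x + z | z in B], [set y + z | z in B]) => /=.
  by split; apply/nbhsVE; exists B => // z Bz; exists z.
by move=> [_ _] /= [[s Bs <-] [t Bt <-]]; rewrite addrACA; apply/AU/BA.
Qed.

HB.instance Definition _ :=
  PreTopologicalNmodule_isTopologicalNmodule.Build V add_continuous.

Let scale_continuous : continuous (fun z : R^o * V => z.1 *: z.2).
Proof.
move=> [a x] U /nbhsVE[A bA /= AU].
have [B bB BA] := zbaseD bA; have [C bC CB] := zbaseD bB.
have [e e0 Ce] := zbase_absorb x bC.
(* D is C halved n times, where 2 ^ n dominates every scalar near a *)
have [D bD DC] : exists2 D, zbase D &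
    forall y (b : R), D y -> `|b| <= `|a| + 1 -> C (b *: y).
  have [n an] : exists n : nat, `|a| + 1 <= 2 ^+ n.
    exists (Num.bound (`|a| + 1)); rewrite (le_trans (ltW (archi_boundP _)))//.
    by rewrite -natrX ler_nat ltnW// ltn_expl.
  suff [D bD DC] : exists2 D, zbase D & forall y, D y -> C (2 ^+ n *: y).
    exists D => // y b /DC Cy ban; rewrite -[b](@divfK _ (2 ^+ n)).
      rewrite -scalerA; apply: solid_scale (zbase_solid bC) _ Cy.
      rewrite normrM normfV (@ger0_norm _ (2 ^+ n)) ?exprn_ge0//.
      by rewrite ler_pdivrMr ?exprn_gt0// mul1r (le_trans ban).
    by rewrite expf_neq0.
  elim: n {an} => [|n [D bD DC]].
    by exists C => // y; rewrite expr0 scale1r.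
  have [E bE ED] := zbaseD bD; exists E => // y Ey.
  rewrite exprS mulrC -scalerA scaler_nat mulr2n.
  by apply: DC; apply: ED.
exists ([set b : R | `|b - a| < Num.min 1 e], [set x + z | z in D]) => /=.
  split; last by apply/nbhsVE; exists D => // z Dz; exists z.
  have m0 : 0 < Num.min 1 e by rewrite lt_min ltr01.
  by exists (Num.min 1 e) => // b /=; rewrite distrC.
move=> [b _] /= [ba [y Dy <-]].
have -> : b *: (x + y) = a *: x + (b *: y + (b - a) *: x).
  by rewrite [RHS]addrC scalerBl -addrA subrK addrC scalerDr.
apply: AU.
(* b y is small by the choice of D, and (b - a) x by that of e *)
apply: BA; last first.
  rewrite -[_ *: _]add0r; apply: CB; first exact: zbase0.
  rewrite -[b - a](@divfK _ e) ?gt_eqF// -scalerA.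
  apply: solid_scale (zbase_solid bC) _ Ce.
  rewrite normrM normfV (gtr0_norm e0) ler_pdivrMr// mul1r ltW//.
  by rewrite (lt_le_trans ba)// ge_min lexx orbT.
rewrite -[_ *: _]add0r; apply: CB; first exact: zbase0.
apply: DC => //; rewrite -[b](subrK a) addrC (le_trans (ler_normD _ _))//.
by rewrite lerD2l ltW// (lt_le_trans ba)// ge_min lexx.
Qed.

HB.instance Definition _ :=
  TopologicalNmodule_isTopologicalLmodule.Build R V scale_continuous.

Let solidV (U : set V) : nbhs 0 U ->
  exists S : set V, [/\ nbhs 0 S, solid S & S `<=` U].
Proof.
move=> /nbhsVE[A bA AU]; exists A; split; last 1 first.
- by move=> y /AU; rewrite add0r.
- by apply/nbhsVE; exists A => // y; rewrite add0r.
- exact: zbase_solid.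
Qed.

HB.instance Definition _ :=
  TopologicalLmodule_isLocallySolid.Build R V solidV.

HB.end.

(** * Neighborhoods of zero and nets *)

Section ZeroNeighborhoods.
Context {R : realType} {V : topologicalLmodType R}.

Lemma nbhs_zeroE (x : V) (U : set V) :
  nbhs x U <-> nbhs 0 [set y | U (x + y)].
Proof.
have trans (a b : V) : (fun y => a + y) @ b --> a + b.
  apply: (@continuous_comp _ _ _ (fun y => (a, y)) (fun p : V * V => p.1 + p.2)).
    by apply: cvg_pair => /=; [exact: cvg_cst|exact: cvg_id].
  exact: add_continuous.
split=> [xU|U0]; first by apply: (trans x 0); rewrite addr0.
have /= := trans (- x) x _; rewrite addNr => /(_ _ U0) /=.
by rewrite /nbhs/=; apply: filterS => y /=; rewrite addNKr.
Qed.

Lemma nbhs_zero_near (x : V) (U : set V) : nbhs 0 U -> nbhs x [set y | U (y - x)].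
Proof.
move=> U0; apply/nbhs_zeroE; apply: filterS U0 => y Uy /=.
by rewrite addrC addKr.
Qed.

Lemma net_cvgP (I : directedSet) (x : I -> V) (l : V) :
  x @ tails I --> l <->
  forall U, nbhs 0 U -> exists i0, forall i, dle i0 i -> U (x i - l).
Proof.
split=> [xl U /(nbhs_zero_near l)/xl[i0 _ xU]|xl U /nbhs_zeroE/xl[i0 xU]].
  by exists i0 => i /xU.
by exists i0 => // i /xU /=; rewrite addrC subrK.
Qed.

End ZeroNeighborhoods.

Section LocallySolidTheory.
Context {R : realType} {V : locallySolidType R}.

Lemma nbhs_half (U : set V) : nbhs 0 U ->
  exists S : set V, [/\ nbhs 0 S, solid S & forall x y, S x -> S y -> U (x + y)].
Proof.
move=> U0; have := @add_continuous V (0, 0) U; rewrite /= addr0 => /(_ U0).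
move=> [[A B]] /= [A0 B0] ABU.
have [S [S0 sS SAB]] := locally_solid _ (filterI A0 B0).
by exists S; split=> // x y /SAB[Ax _] /SAB[_ By]; apply: (ABU (x, y)).
Qed.

Lemma nbhs_scale (a : R) (U : set V) : nbhs 0 U -> nbhs 0 [set x | U (a *: x)].
Proof.
move=> U0; have := @scale_continuous R V (a, 0) U; rewrite /= scaler0 => /(_ U0).
move=> [[A B]] /= [/nbhs_singleton Aa B0] ABU.
by apply: filterS B0 => x Bx; apply: (ABU (a, x)).
Qed.

Lemma nbhs_absorb (U : set V) (x : V) : nbhs 0 U -> exists2 a : R, 0 < a & U (a *: x).
Proof.
move=> U0; have := @scale_continuous R V (0, x) U; rewrite /= scale0r => /(_ U0).
move=> [[A B]] /= [[e /= e0 Ae] /nbhs_singleton Bx] ABU.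
exists (e / 2); first by rewrite divr_gt0.
apply: (ABU (e / 2, x)); split=> //=; apply: Ae => /=.
by rewrite sub0r normrN gtr0_norm ?divr_gt0//; lra.
Qed.

Lemma hausdorff_zeroP : hausdorff_space V <->
  (forall x : V, (forall U, nbhs 0 U -> U x) -> x = 0).
Proof.
split=> [hV x xU|hV p q clpq].
  apply/esym/hV => A B A0 /nbhs_zeroE B0.
  have [S [S0 sS SB]] := locally_solid _ B0.
  exists 0; split; first exact: nbhs_singleton.
  have /SB/= := solidN sS (xU _ S0); by rewrite subrr.
apply/eqP; rewrite -subr_eq0; apply/eqP/hV => U U0.
have [S [S0 sS SU]] := nbhs_half U0.
have [r [rp rq]] := clpq _ _ (nbhs_zero_near p S0) (nbhs_zero_near q S0).
by rewrite -(subrKA r); apply: SU => //; rewrite -opprB; exact: solidN.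
Qed.

End LocallySolidTheory.

Section Nets.
Context {R : realType} {V : locallySolidType R} {I : directedSet}.
Implicit Types x y : I -> V.

Definition eventually_in (P : I -> Prop) := exists i0, forall i, dle i0 i -> P i.

Definition null_net x := forall U, nbhs 0 U -> eventually_in (fun i => U (x i)).

Lemma eventually_inI (P Q S : I -> Prop) : (forall i, P i -> Q i -> S i) ->
  eventually_in P -> eventually_in Q -> eventually_in S.
Proof.
move=> PQS [i Pi] [j Qj]; have [k [ik jk]] := dle_directed i j.
exists k => l kl; apply: PQS; first exact/Pi/(dle_trans ik).
exact/Qj/(dle_trans jk).
Qed.

Lemma eventually_in_ex (P : I -> Prop) : eventually_in P -> exists i, P i.
Proof. by move=> [i Pi]; exists i; exact/Pi/dle_refl. Qed.

Lemma null_cst0 : null_net (fun=> 0).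
Proof.
move=> U /nbhs_singleton U0.
by have [i] := d_inhabited I; exists i.
Qed.

Lemma null_netD x y : null_net x -> null_net y -> null_net (fun i => x i + y i).
Proof.
move=> x0 y0 U /nbhs_half[S [S0 _ SU]].
by apply: (eventually_inI _ (x0 _ S0) (y0 _ S0)) => i; exact: SU.
Qed.

Lemma null_net_le x y : (forall i, vabs (x i) <= vabs (y i)) ->
  null_net y -> null_net x.
Proof.
move=> xy y0 U /locally_solid[S [S0 sS SU]].
by have [i0 yS] := y0 _ S0; exists i0 => i /yS yi; apply/SU/(sS _ (y i)).
Qed.

Lemma null_netZ (a : R) x : null_net x -> null_net (fun i => a *: x i).
Proof. by move=> x0 U /(nbhs_scale a)/x0. Qed.

Lemma cauchy_cst (v : V) : cauchy_net (fun _ : I => v).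
Proof.
move=> U /nbhs_singleton U0; have [i] := d_inhabited I.
by exists i => j k _ _; rewrite subrr.
Qed.

(** Common source of the stability of Cauchy nets under addition and join: both
    are dominated by the sum of the variations of their arguments. *)
Lemma cauchy_le x y z :
  (forall i j, vabs (z i - z j) <= vabs (x i - x j) + vabs (y i - y j)) ->
  cauchy_net x -> cauchy_net y -> cauchy_net z.
Proof.
move=> zxy xC yC U /locally_solid[T [T0 sT TU]].
have [S [S0 sS ST]] := nbhs_half T0.
have [i xi] := xC _ S0; have [j yj] := yC _ S0.
have [k [ik jk]] := dle_directed i j; exists k => l m kl km; apply: TU.
apply: (sT _ (vabs (x l - x m) + vabs (y l - y m))).
  by rewrite [leRHS]ger0_vabs// -[0]addr0 vleD ?vabs_ge0.
have abs v : S v -> S (vabs v) by apply: sS; rewrite vabs_id.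
by apply: ST; apply: abs; [apply: xi|apply: yj];
  by [apply: (dle_trans ik)|apply: (dle_trans jk)].
Qed.

Lemma cauchyD x y : cauchy_net x -> cauchy_net y -> cauchy_net (fun i => x i + y i).
Proof.
apply: cauchy_le => i j; rewrite opprD addrACA; exact: vabsD.
Qed.

Lemma cauchy_join x y :
  cauchy_net x -> cauchy_net y -> cauchy_net (fun i => vjoin (x i) (y i)).
Proof. by apply: cauchy_le => i j; exact: vabs_join. Qed.

Lemma cauchyZ (a : R) x : cauchy_net x -> cauchy_net (fun i => a *: x i).
Proof.
move=> xC U /(nbhs_scale a)/xC[i0 xi]; exists i0 => i j /xi/[apply]/=.
by rewrite scalerBr.
Qed.

Lemma cauchyN x : cauchy_net x -> cauchy_net (fun i => - x i).
Proof.
move=> /(cauchyZ (-1)); congr cauchy_net.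
by apply/funext => i; rewrite scaleN1r.
Qed.

Lemma cauchyB x y : cauchy_net x -> cauchy_net y -> cauchy_net (fun i => x i - y i).
Proof. by move=> xC yC; apply: cauchyD => //; exact: cauchyN. Qed.

End Nets.

(** * Points of the completion *)

Section CompletionPoints.
Context {R : realType} (X : locallySolidType R).
Local Open Scope quotient_scope.

(** The completion consists of Cauchy nets modulo null nets. One fixed directed
    set is enough as index: a point of the completion is approximated, for each
    zero-neighborhood U, by a point of X up to U. Restricting to solid U loses
    nothing and makes the induced sets in the completion solid. *)
Definition solid_zero_nbhs := {U : set X | nbhs 0 U /\ solid U}.

Definition finer (U W : solid_zero_nbhs) := sval W `<=` sval U.

Let finer_refl U : finer U U. Proof. by []. Qed.

Let finer_trans W U T : finer U W -> finer W T -> finer U T.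
Proof. by move=> UW WT x /WT/UW. Qed.

Let finer_directed U W : exists T, finer U T /\ finer W T.
Proof.
case: U W => [U [U0 sU]] [W [W0 sW]].
have UW : nbhs 0 (U `&` W) /\ solid (U `&` W).
  split; first exact: filterI.
  by move=> x y xy [Uy Wy]; split; [exact: (sU _ _ xy)|exact: (sW _ _ xy)].
by exists (exist (fun U => nbhs 0 U /\ solid U) _ UW); split=> x [].
Qed.

Let solid_zero_nbhs_inhabited : inhabited solid_zero_nbhs.
Proof.
constructor; exists setT; split; last by [].
exact: filterT.
Qed.

Definition zero_nbhs_dir : directedSet :=
  DirectedSet finer_refl finer_trans finer_directed solid_zero_nbhs_inhabited.

Lemma zero_nbhs_dirP (U : set X) : nbhs 0 U ->
  exists i : zero_nbhs_dir, sval i `<=` U.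
Proof.
move=> /locally_solid[S [S0 sS SU]].
by exists (exist (fun U => nbhs 0 U /\ solid U) S (conj S0 sS)).
Qed.

Definition cauchy_nets := {x : zero_nbhs_dir -> X | `[< cauchy_net x >]}.

Definition same_limit (x y : cauchy_nets) :=
  `[< null_net (fun i => val x i - val y i) >].

Let same_limit_refl : reflexive same_limit.
Proof.
move=> x; apply/asboolP; under eq_fun do rewrite subrr; exact: null_cst0.
Qed.

Let same_limit_sym : symmetric same_limit.
Proof.
move=> x y; rewrite /same_limit; apply: asbool_equiv_eq.
by split; apply: null_net_le => i; rewrite -vabsN opprB.
Qed.

Let same_limit_trans : transitive same_limit.
Proof.
move=> y x z /asboolP xy /asboolP yz; apply/asboolP.
by have := null_netD xy yz; under eq_fun do rewrite subrKA.
Qed.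

Canonical same_limit_equiv :=
  EquivRel same_limit same_limit_refl same_limit_sym same_limit_trans.

Definition completion := {eq_quot same_limit}.

HB.instance Definition _ := Choice.on completion.

Let cauchy0 : `[< cauchy_net (fun _ : zero_nbhs_dir => 0 : X) >].
Proof. exact/asboolP/cauchy_cst. Qed.

Definition netlim (x : zero_nbhs_dir -> X) : completion :=
  \pi_({eq_quot same_limit})
    (insubd (exist (fun x => `[< cauchy_net x >]) _ cauchy0 : cauchy_nets) x).

Definition net_of (z : completion) : zero_nbhs_dir -> X :=
  val (repr (z : {eq_quot same_limit})).

Lemma net_of_cauchy (z : completion) : cauchy_net (net_of z).
Proof. exact/asboolP/(valP (repr (z : {eq_quot same_limit}))). Qed.

Lemma net_ofK (z : completion) : netlim (net_of z) = z.
Proof. by rewrite /netlim /net_of valKd reprK. Qed.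

(** All computations in the completion go through this equivalence and the
    lifting lemmas that follow it, so that an equation holds in the completion
    as soon as it holds in X. *)
Lemma netlimP (x y : zero_nbhs_dir -> X) : cauchy_net x -> cauchy_net y ->
  netlim x = netlim y <-> null_net (fun i => x i - y i).
Proof.
move=> /asboolP xC /asboolP yC; split=> [/eqP|xy].
  by rewrite /netlim eqmodE => /asboolP; rewrite !insubdK.
by apply/eqP; rewrite /netlim eqmodE; apply/asboolP; rewrite !insubdK.
Qed.

Lemma net_of_netlim (x : zero_nbhs_dir -> X) : cauchy_net x ->
  null_net (fun i => net_of (netlim x) i - x i).
Proof.
move=> xC; apply/netlimP => //; first exact: net_of_cauchy.
exact: net_ofK.
Qed.

Definition addh (z w : completion) := netlim (fun i => net_of z i + net_of w i).
Definition opph (z : completion) := netlim (fun i => - net_of z i).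
Definition scaleh (a : R) (z : completion) := netlim (fun i => a *: net_of z i).
Definition joinh (z w : completion) :=
  netlim (fun i => vjoin (net_of z i) (net_of w i)).

Section Lift.
Variables (x y : zero_nbhs_dir -> X).
Hypotheses (xC : cauchy_net x) (yC : cauchy_net y).

Lemma addh_netlim : addh (netlim x) (netlim y) = netlim (fun i => x i + y i).
Proof.
apply/netlimP; [by apply: cauchyD; exact: net_of_cauchy|exact: cauchyD|].
apply: (null_net_le _ (null_netD (net_of_netlim xC) (net_of_netlim yC))) => i.
by rewrite opprD addrACA.
Qed.

Lemma scaleh_netlim a : scaleh a (netlim x) = netlim (fun i => a *: x i).
Proof.
apply/netlimP; [by apply: cauchyZ; exact: net_of_cauchy|exact: cauchyZ|].
apply: (null_net_le _ (null_netZ a (net_of_netlim xC))) => i.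
by rewrite -scalerBr.
Qed.

Lemma opph_netlim : opph (netlim x) = netlim (fun i => - x i).
Proof.
apply/netlimP; [by apply: cauchyN; exact: net_of_cauchy|exact: cauchyN|].
apply: (null_net_le _ (net_of_netlim xC)) => i.
by rewrite -opprD vabsN.
Qed.

Lemma joinh_netlim :
  joinh (netlim x) (netlim y) = netlim (fun i => vjoin (x i) (y i)).
Proof.
apply/netlimP; [by apply: cauchy_join; exact: net_of_cauchy|exact: cauchy_join|].
have abs u : null_net u -> null_net (fun i : zero_nbhs_dir => vabs (u i) : X).
  by apply: null_net_le => i; rewrite vabs_id.
have := null_netD (abs _ (net_of_netlim xC)) (abs _ (net_of_netlim yC)).
apply: null_net_le => i; rewrite [leRHS]ger0_vabs ?vabs_join//.
by rewrite -[0]addr0 vleD ?vabs_ge0.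
Qed.

End Lift.

Lemma netlim_ind (P : completion -> Prop) :
  (forall x, cauchy_net x -> P (netlim x)) -> forall z, P z.
Proof. by move=> h z; rewrite -[z]net_ofK; apply/h/net_of_cauchy. Qed.

Let addhA : associative addh.
Proof.
elim/netlim_ind => x xC; elim/netlim_ind => y yC; elim/netlim_ind => z zC.
rewrite !addh_netlim//; [|exact: cauchyD..].
by congr netlim; apply/funext => i; rewrite addrA.
Qed.

Let addhC : commutative addh.
Proof.
elim/netlim_ind => x xC; elim/netlim_ind => y yC.
by rewrite !addh_netlim//; congr netlim; apply/funext => i; rewrite addrC.
Qed.

Let add0h : left_id (netlim (fun=> 0)) addh.
Proof.
elim/netlim_ind => x xC; rewrite addh_netlim//; last exact: cauchy_cst.
by congr netlim; apply/funext => i; rewrite add0r.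
Qed.

Let addNh : left_inverse (netlim (fun=> 0)) opph addh.
Proof.
elim/netlim_ind => x xC; rewrite opph_netlim// addh_netlim//; last exact: cauchyN.
by congr netlim; apply/funext => i; rewrite addNr.
Qed.

HB.instance Definition _ := GRing.isZmodule.Build completion addhA addhC add0h addNh.

Let scalehA (a b : R) (z : completion) : scaleh a (scaleh b z) = scaleh (a * b) z.
Proof.
elim/netlim_ind: z => x xC; rewrite !scaleh_netlim//; last exact: cauchyZ.
by congr netlim; apply/funext => i; rewrite scalerA.
Qed.

Let scale1h : left_id 1 scaleh.
Proof.
elim/netlim_ind => x xC; rewrite scaleh_netlim//.
by congr netlim; apply/funext => i; rewrite scale1r.
Qed.

Let scalehDr : right_distributive scaleh +%R.
Proof.
move=> a; elim/netlim_ind => x xC; elim/netlim_ind => y yC.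
rewrite /GRing.add/= addh_netlim// !scaleh_netlim//; last exact: cauchyD.
rewrite addh_netlim//; [|exact: cauchyZ..].
by congr netlim; apply/funext => i; rewrite scalerDr.
Qed.

Let scalehDl (z : completion) : {morph scaleh^~ z : a b / a + b}.
Proof.
elim/netlim_ind: z => x xC a b; rewrite [RHS]/GRing.add/= !scaleh_netlim//.
rewrite addh_netlim//; [|exact: cauchyZ..].
by congr netlim; apply/funext => i; rewrite scalerDl.
Qed.

HB.instance Definition _ := GRing.Zmodule_isLmodule.Build R completion
  scalehA scale1h scalehDr scalehDl.

Lemma netlimD x y : cauchy_net x -> cauchy_net y ->
  netlim (fun i => x i + y i) = netlim x + netlim y.
Proof. by move=> xC yC; rewrite -addh_netlim. Qed.

Lemma netlimN x : cauchy_net x -> netlim (fun i => - x i) = - netlim x.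
Proof. by move=> xC; rewrite -opph_netlim. Qed.

Lemma netlimB x y : cauchy_net x -> cauchy_net y ->
  netlim (fun i => x i - y i) = netlim x - netlim y.
Proof. by move=> xC yC; rewrite -netlimN// -netlimD//; exact: cauchyN. Qed.

Lemma netlimZ a x : cauchy_net x -> netlim (fun i => a *: x i) = a *: netlim x.
Proof. by move=> xC; rewrite -scaleh_netlim. Qed.

Let joinhC : commutative joinh.
Proof.
elim/netlim_ind => x xC; elim/netlim_ind => y yC.
by rewrite !joinh_netlim//; congr netlim; apply/funext => i; rewrite vjoinC.
Qed.

Let joinhA : associative joinh.
Proof.
elim/netlim_ind => x xC; elim/netlim_ind => y yC; elim/netlim_ind => z zC.
rewrite !joinh_netlim//; [|exact: cauchy_join..].
by congr netlim; apply/funext => i; rewrite vjoinA.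
Qed.

Let joinhh : idempotent_op joinh.
Proof.
elim/netlim_ind => x xC; rewrite joinh_netlim//.
by congr netlim; apply/funext => i; rewrite vjoinxx.
Qed.

Let joinhDr (z x y : completion) : joinh (x + z) (y + z) = joinh x y + z.
Proof.
elim/netlim_ind: z => z zC; elim/netlim_ind: x => x xC; elim/netlim_ind: y => y yC.
rewrite -(netlimD xC zC) -(netlimD yC zC) !joinh_netlim//; [|exact: cauchyD..].
rewrite -netlimD//; last exact: cauchy_join.
by congr netlim; apply/funext => i; rewrite vjoinDr.
Qed.

Let joinh_scale (a : R) (z : completion) : 0 <= a ->
  joinh 0 (a *: z) = a *: joinh 0 z.
Proof.
move=> a0; elim/netlim_ind: z => x xC.
have cst0 : cauchy_net (fun _ : zero_nbhs_dir => 0 : X) := cauchy_cst 0.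
have -> : 0 = netlim (fun=> 0) by [].
rewrite -netlimZ// !joinh_netlim//; last exact: cauchyZ.
rewrite -netlimZ//; last exact: cauchy_join.
congr netlim; apply/funext => i.
by rewrite -[X in vjoin X _](scaler0 _ a) vjoin_scale.
Qed.

HB.instance Definition _ := Lmodule_hasJoin.Build R completion
  joinhC joinhA joinhh joinhDr joinh_scale.

Lemma netlimJ x y : cauchy_net x -> cauchy_net y ->
  netlim (fun i => vjoin (x i) (y i)) = vjoin (netlim x) (netlim y).
Proof. by move=> xC yC; rewrite -joinh_netlim. Qed.

End CompletionPoints.

(** * Topology of the completion *)

Section CompletionTopology.
Context {R : realType} (X : locallySolidType R).
Local Notation D := (zero_nbhs_dir X).

Lemma netlim_surj (z : completion X) : exists2 x : D -> X, cauchy_net x & netlim x = z.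
Proof. by exists (net_of z); [exact: net_of_cauchy|exact: net_ofK]. Qed.

Lemma netlim_abs (x : D -> X) : cauchy_net x ->
  netlim (fun i => vabs (x i)) = vabs (netlim x).
Proof. by move=> xC; rewrite /vabs netlimJ ?netlimN//; exact: cauchyN. Qed.

Lemma cauchy_abs (x : D -> X) : cauchy_net x -> cauchy_net (fun i => vabs (x i)).
Proof. by move=> xC; apply: cauchy_join => //; exact: cauchyN. Qed.

(** The quantification over all representatives, and not only the chosen one, is
    what makes these sets exactly solid and exactly compatible with sums: a
    representative can be adjusted to the purpose at hand. *)
Definition nbhs_hat (U : set X) : set (completion X) :=
  [set z | exists2 x : D -> X, cauchy_net x &
    netlim x = z /\ eventually_in (fun i => U (x i))].

Let hat_base : set_system (completion X) :=
  [set A | exists2 U, nbhs 0 U /\ solid U & A = nbhs_hat U].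

Lemma nbhs_hatS (U W : set X) : U `<=` W -> nbhs_hat U `<=` nbhs_hat W.
Proof.
move=> UW z [x xC [xz [i xU]]]; exists x => //; split=> //.
by exists i => j /xU/UW.
Qed.

(** If |z| <= |w| and w is the limit of y, then z is the limit of its own net
    truncated between -|y| and |y|. *)
Lemma nbhs_hat_solid (U : set X) : solid U -> solid (nbhs_hat U).
Proof.
move=> sU z w zw [y yC [yw yU]]; have [x xC xz] := netlim_surj z.
pose t i := vjoin (- vjoin (- x i) (- vabs (y i))) (- vabs (y i)).
have aC := cauchy_abs yC; have aNC := cauchyN aC; have xNC := cauchyN xC.
have jC := cauchyN (cauchy_join xNC aNC).
exists t; first exact: cauchy_join.
split.
  rewrite netlimJ// netlimN; last exact: cauchy_join.
  rewrite netlimJ// !netlimN// netlim_abs// xz yw.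
  have wz : - vabs w <= - z by rewrite vleN2 (le_trans (vabs_ge _) zw).
  have wz' : - vabs w <= z by rewrite -vleN2 opprK (le_trans (vabs_geN _) zw).
  rewrite [vjoin (- z) _]vjoinC (vjoin_idPr _ _ wz) opprK vjoinC.
  exact/vjoin_idPr.
have [i yi] := yU; exists i => j /yi; apply: sU; apply/vabs_leP; split.
  apply: vjoin_lub; first by rewrite -vleN2 opprK vle_joinr.
  by rewrite (@le_trans _ _ 0) ?vabs_ge0// -oppr0 vleN2 vabs_ge0.
by rewrite -vleN2 opprK vle_joinr.
Qed.

Lemma nbhs_hatD (U W : set X) : (forall x y, U x -> U y -> W (x + y)) ->
  forall z w, nbhs_hat U z -> nbhs_hat U w -> nbhs_hat W (z + w).
Proof.
move=> UW z w [x xC [<- xU]] [y yC [<- yU]].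
exists (fun i => x i + y i); first exact: cauchyD.
split; first by rewrite netlimD.
by apply: (eventually_inI _ xU yU) => i; exact: UW.
Qed.

Let hat_baseT : exists A, hat_base A.
Proof. by exists (nbhs_hat setT), setT => //; split=> //; exact: filterT. Qed.

Let hat_baseI A B : hat_base A -> hat_base B ->
  exists2 C, hat_base C & C `<=` A `&` B.
Proof.
move=> [U [U0 sU] ->] [W [W0 sW] ->]; exists (nbhs_hat (U `&` W)).
  exists (U `&` W) => //; split; first exact: filterI.
  by move=> x y xy [Uy Wy]; split; [exact: (sU _ _ xy)|exact: (sW _ _ xy)].
by move=> z UWz; split; move: UWz; apply: nbhs_hatS => x [].
Qed.

Let hat_base_solid A : hat_base A -> solid A.
Proof. by move=> [U [_ sU] ->]; exact: nbhs_hat_solid. Qed.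

Let hat_baseD A : hat_base A ->
  exists2 B, hat_base B & forall z w, B z -> B w -> A (z + w).
Proof.
move=> [U [U0 sU] ->]; have [S [S0 sS SU]] := nbhs_half U0.
by exists (nbhs_hat S); [exists S|exact: nbhs_hatD].
Qed.

Let hat_base_absorb A (z : completion X) : hat_base A ->
  exists2 a : R, 0 < a & A (a *: z).
Proof.
move=> [U [U0 sU] ->]; have [S [S0 sS SU]] := nbhs_half U0.
have [x xC <-] := netlim_surj z; have [i xi] := xC _ S0.
have [a a0 Sa] := nbhs_absorb (x i) S0.
have b0 : 0 < Num.min a 1 by rewrite lt_min a0 ltr01.
exists (Num.min a 1) => //; rewrite -netlimZ//.
exists (fun j => Num.min a 1 *: x j); first exact: cauchyZ.
split=> //; exists i => j ij.
rewrite -[x j](subrK (x i)) scalerDr; apply: SU.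
  apply: solid_scale => //; last by apply: xi => //; exact: dle_refl.
  by rewrite gtr0_norm// ge_min lexx orbT.
rewrite -[Num.min a 1](@divfK _ a) ?gt_eqF// -scalerA; apply: solid_scale => //.
rewrite gtr0_norm ?divr_gt0// ler_pdivrMr// mul1r.
by rewrite ge_min lexx.
Qed.

HB.instance Definition _ := VectorLattice_hasSolidBase.Build R (completion X)
  hat_baseT hat_baseI hat_base_solid hat_baseD hat_base_absorb.

Lemma nbhs_hat_nbhs (U : set X) : nbhs 0 U -> nbhs 0 (nbhs_hat U).
Proof.
move=> /locally_solid[S [S0 sS SU]].
by exists (nbhs_hat S); [exists S|move=> z; rewrite add0r; exact: nbhs_hatS].
Qed.

Lemma nbhs_hat_basis (A : set (completion X)) : nbhs 0 A ->
  exists U, [/\ nbhs 0 U, solid U & nbhs_hat U `<=` A].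
Proof.
move=> [_ [U [U0 sU] ->] UA]; exists U; split=> // z /UA.
by rewrite add0r.
Qed.

(** An arbitrary representative differs from the one provided by [nbhs_hat] by a
    null net, which costs one more halving. *)
Lemma nbhs_hat_rep (U S : set X) (x : D -> X) :
  (forall x y, S x -> S y -> U (x + y)) -> nbhs 0 S ->
  cauchy_net x -> nbhs_hat S (netlim x) -> eventually_in (fun i => U (x i)).
Proof.
move=> SU S0 xC [y yC [/(netlimP yC xC) /null_net_le yx yS]].
have /yx/(_ _ S0) xy : forall i, vabs (x i - y i) <= vabs (y i - x i).
  by move=> i; rewrite -vabsN opprB.
by apply: (eventually_inI _ xy yS) => i xyi yi; rewrite -(subrK (y i) (x i)); exact: SU.
Qed.

Lemma completion_is_hausdorff : hausdorff_space (completion X).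
Proof.
apply/hausdorff_zeroP => z; have [x xC <-] := netlim_surj z => zU.
rewrite -[0]/(netlim (fun=> 0)); apply/netlimP => //; first exact: cauchy_cst.
move=> U /nbhs_half[S [S0 sS SU]].
have := nbhs_hat_rep SU S0 xC (zU _ (nbhs_hat_nbhs S0)).
by congr eventually_in; apply/funext => i; rewrite subr0.
Qed.

Definition embed (x : X) : completion X := netlim (fun=> x).

Let embed_linear : linear embed.
Proof.
move=> a x y; rewrite /embed -netlimZ; last exact: cauchy_cst.
by rewrite -netlimD//; exact: cauchy_cst.
Qed.

HB.instance Definition _ :=
  GRing.isLinear.Build R X (completion X) _ embed embed_linear.

Lemma embedJ : {morph embed : x y / vjoin x y}.
Proof. by move=> x y; rewrite /embed -netlimJ//; exact: cauchy_cst. Qed.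

Lemma embedM : {morph embed : x y / vmeet x y}.
Proof. by move=> x y; rewrite !vmeetE -embedJ raddfB raddfD. Qed.

Lemma nbhs_hat_embed (U : set X) x : U x -> nbhs_hat U (embed x).
Proof.
move=> Ux; exists (fun=> x); first exact: cauchy_cst.
by split=> //; have [i] := d_inhabited D; exists i.
Qed.

Lemma nbhs_hat_embedP (U S : set X) x :
  (forall x y, S x -> S y -> U (x + y)) -> nbhs 0 S ->
  nbhs_hat S (embed x) -> U x.
Proof.
move=> SU S0 Sx; have := nbhs_hat_rep SU S0 _ Sx.
by move=> /(_ (cauchy_cst x))/eventually_in_ex[].
Qed.

Lemma embed_approx (x : D -> X) (U : set X) : nbhs 0 U -> cauchy_net x ->
  eventually_in (fun i => nbhs_hat U (netlim x - embed (x i))).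
Proof.
move=> U0 xC; have [i xi] := xC _ U0; exists i => j ij.
rewrite /embed -netlimB//; last exact: cauchy_cst.
exists (fun k => x k - x j); first by apply: cauchyB => //; exact: cauchy_cst.
by split=> //; exists i => k ik; exact: xi.
Qed.

Lemma embed_continuous : continuous embed.
Proof.
move=> x A /nbhs_zeroE/nbhs_hat_basis[U [U0 sU UA]]; apply/nbhs_zeroE.
apply: filterS U0 => y Uy /=; rewrite raddfD.
exact/UA/nbhs_hat_embed.
Qed.

Lemma embed_embedding : hausdorff_space X -> topological_embedding embed.
Proof.
move=> /hausdorff_zeroP hX; split=> [x y xy|A].
  apply/eqP; rewrite -subr_eq0; apply/eqP/hX => U U0.
  have [S [S0 sS SU]] := nbhs_half U0; apply: (nbhs_hat_embedP SU) => //.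
  by rewrite raddfB /= xy subrr; apply: nbhs_singleton; exact: nbhs_hat_nbhs.
split=> [Ao|[B Bo <-]]; last first.
  by apply: open_comp Bo => x _; exact: embed_continuous.
exists (\bigcup_(O in [set O | open O /\ embed @^-1` O `<=` A]) O).
  by apply: bigcup_open => O [].
apply/seteqP; split=> [x [B [_ BA]]|x Ax]; first exact: BA.
have /nbhs_zeroE/nbhs_half[S [S0 sS SA]] := open_nbhs_nbhs (conj Ao Ax).
pose W := [set z | nbhs_hat S (z - embed x)].
exists (W^°); last by apply: nbhs_zero_near; exact: nbhs_hat_nbhs.
split; first exact: open_interior.
move=> y /interior_subset; rewrite /W/= -raddfB.
by move=> /(nbhs_hat_embedP SA S0)/=; rewrite addrC subrK.
Qed.

Lemma embed_dense : dense (range embed).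
Proof.
move=> O [z Oz] Oo; have [x xC xz] := netlim_surj z.
have /nbhs_zeroE/nbhs_hat_basis[U [U0 sU UO]] := open_nbhs_nbhs (conj Oo Oz).
have [i xi] := eventually_in_ex (embed_approx U0 xC).
exists (embed (x i)); split; last by exists (x i).
have /UO/= := solidN (nbhs_hat_solid sU) xi.
by rewrite opprB xz addrC subrK.
Qed.

(** A Cauchy net in the completion, on any index set, is followed by a net y of
    points of X indexed by the zero-neighborhoods, and the class of y is its
    limit. *)
Lemma completion_is_complete : complete_space (completion X).
Proof.
move=> I a aC.
(* beyond m U the net a varies by less than U, and y U approximates a (m U) *)
have /choice[m mP] : forall U : D, exists i, forall j, dle i j ->
    nbhs_hat (sval U) (a i - a j).
  move=> [U [U0 sU]]; have [i ai] := aC _ (nbhs_hat_nbhs U0).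
  by exists i => j ij; apply: ai => //; exact: dle_refl.
have /choice[y yP] : forall U : D, exists x, nbhs_hat (sval U) (a (m U) - embed x).
  move=> U; have [U0 sU] := svalP U; have [x xC <-] := netlim_surj (a (m U)).
  have [i xi] := eventually_in_ex (embed_approx U0 xC).
  by exists (x i).
have yC : cauchy_net y.
  move=> W /nbhs_half[S [S0 sS SW]].
  have [S1 [S10 sS1 S1S]] := nbhs_half S0.
  have [S2 [S20 sS2 S2S1]] := nbhs_half S10.
  have [U0 U0S2] := zero_nbhs_dirP S20.
  have near U k : finer U0 U -> dle (m U) k -> nbhs_hat S1 (embed (y U) - a k).
    move=> U0U mk; rewrite -(subrKA (a (m U))).
    apply: (nbhs_hatD S2S1); apply: (nbhs_hatS (subset_trans U0U U0S2)).
      by rewrite -opprB; apply: solidN (yP U); exact: (nbhs_hat_solid (svalP U).2).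
    exact: mP.
  exists U0 => U U' U0U U0U'; apply: (nbhs_hat_embedP SW S0).
  have [k [kU kU']] := dle_directed (m U) (m U').
  rewrite raddfB -(subrKA (a k)); apply: (nbhs_hatD S1S); first exact: near.
  by rewrite -opprB; apply: solidN (near _ _ _ _) => //; exact: nbhs_hat_solid.
exists (netlim y); apply/net_cvgP => A /nbhs_hat_basis[W [W0 sW WA]].
have [S [S0 sS SW]] := nbhs_half W0.
have [S1 [S10 sS1 S1S]] := nbhs_half S0.
have [U0 yU0] := embed_approx S10 yC.
have [U1 U1S1] := zero_nbhs_dirP S10.
have [U [U0U U1U]] := dle_directed U0 U1.
exists (m U) => i mi; apply: WA; rewrite -(subrKA (embed (y U))).
apply: (nbhs_hatD SW); last first.
  rewrite -opprB; apply: solidN; first exact: nbhs_hat_solid.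
  apply: (@nbhs_hatS S1); last exact: yU0.
  by move=> x Sx; rewrite -[x]addr0; apply: S1S => //; exact: nbhs_singleton.
rewrite -(subrKA (a (m U))); apply: (nbhs_hatD S1S);
  apply: (nbhs_hatS (subset_trans U1U U1S1)); last exact: yP.
by rewrite -opprB; apply: solidN (mP _ _ mi); exact: (nbhs_hat_solid (svalP U).2).
Qed.

(** A positive limit is also the limit of the positive parts of its net.
    Conversely the distance from z to its positive part is at most the distance
    from z to any positive element, so that it vanishes on the closure. *)
Lemma completion_cone_closure :
  [set z : completion X | 0 <= z] = closure (embed @` [set x : X | 0 <= x]).
Proof.
apply/seteqP; split=> [z /= z0 A|z zcl /=].
  move=> /nbhs_zeroE/nbhs_hat_basis[U [U0 sU UA]].
  have [x xC xz] := netlim_surj z.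
  have jC : cauchy_net (fun i => vjoin 0 (x i)).
    by apply: cauchy_join => //; exact: cauchy_cst.
  have jz : netlim (fun i => vjoin 0 (x i)) = z.
    by rewrite netlimJ ?xz//; [exact/vjoin_idPr|exact: cauchy_cst].
  have [i xi] := eventually_in_ex (embed_approx U0 jC).
  exists (embed (vjoin 0 (x i))); split.
    by exists (vjoin 0 (x i)) => //; exact: vle_joinl.
  have /UA/= := solidN (nbhs_hat_solid sU) xi.
  by rewrite opprB jz addrC subrK.
apply/vjoin_idPr/eqP; rewrite -subr_eq0; apply/eqP.
apply: (hausdorff_zeroP.1 completion_is_hausdorff) => A /locally_solid[S [S0 sS SA]].
have [_ [[x x0 <-]]] := zcl _ (nbhs_zero_near z S0).
have [S' [S'0 sS' S'S]] := nbhs_half S0.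
have [_ [[y y0 <-] /= yz]] := zcl _ (nbhs_zero_near z S'0).
move=> _; apply: SA.
have yE : vjoin 0 (embed y) = embed y.
  apply/vjoin_idPr; have /vjoin_idPr yy := y0.
  by apply/vjoin_idPr; rewrite -[0 in LHS](raddf0 embed) -embedJ yy.
have -> : vjoin 0 z - z = (vjoin 0 z - vjoin 0 (embed y)) + (embed y - z).
  by rewrite yE subrKA.
apply: S'S => //; apply: sS' yz.
by apply: le_trans (vabs_join _ _ _ _) _; rewrite subrr vabs0 add0r -vabsN opprB.
Qed.

Theorem completion_exists : hausdorff_space X -> is_completion embed.
Proof.
move=> hX; split.
- exact: completion_is_hausdorff.
- exact: completion_is_complete.
- exact: embed_embedding.
- exact: embed_dense.
- exact: completion_cone_closure.
- exact: embedJ.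
- exact: embedM.
Qed.

End CompletionTopology.

(** * Step functions on the 2-adic integers *)

Section DyadicPeriod.
Context {T : Type}.

Definition dyadic_period (n : nat) (f : nat -> T) :=
  forall k, f (k + 2 ^ n)%N = f k.

Lemma dyadic_period_mod n (f : nat -> T) : dyadic_period n f ->
  forall k, f (k %% 2 ^ n)%N = f k.
Proof.
move=> fn k; rewrite {2}(divn_eq k (2 ^ n)) addnC.
by elim: (k %/ _)%N => [|m IH]; rewrite ?addn0// mulSn addnCA addnC fn.
Qed.

Lemma dyadic_period_eqmod n (f : nat -> T) (j k : nat) : dyadic_period n f ->
  (j = k %[mod 2 ^ n])%N -> f j = f k.
Proof. by move=> fn jk; rewrite -(dyadic_period_mod fn) jk dyadic_period_mod. Qed.

Lemma dyadic_periodW n m (f : nat -> T) : (n <= m)%N ->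
  dyadic_period n f -> dyadic_period m f.
Proof.
move=> nm fn k; apply: (dyadic_period_eqmod fn).
by rewrite -(subnK nm) expnD addnC modnMDl.
Qed.

End DyadicPeriod.

Section DyadicSpace.
Context {R : realType}.

(** These functions are the step functions on the 2-adic integers, restricted to
    the dense subset of natural numbers. *)
Definition is_dyadic : {pred nat -> R^o} :=
  fun f => `[< exists n, dyadic_period n f >].

Lemma is_dyadicP (f : nat -> R^o) :
  reflect (exists n, dyadic_period n f) (f \in is_dyadic).
Proof. exact: asboolP. Qed.

Lemma common_period (T1 T2 : Type) (f : nat -> T1) (g : nat -> T2) :
  (exists n, dyadic_period n f) -> (exists n, dyadic_period n g) ->
  exists n, dyadic_period n f /\ dyadic_period n g.
Proof.
move=> [n fn] [m gm]; exists (maxn n m).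
by split; [apply: dyadic_periodW fn; rewrite leq_maxl|
           apply: dyadic_periodW gm; rewrite leq_maxr].
Qed.

Let is_dyadic_submod : submod_closed is_dyadic.
Proof.
split; first by apply/is_dyadicP; exists 0%N.
move=> a f g /is_dyadicP fP /is_dyadicP gP; apply/is_dyadicP.
have [n [fn gn]] := common_period fP gP; exists n => k.
by rewrite /GRing.add/= /GRing.scale/= fn gn.
Qed.

HB.instance Definition _ :=
  GRing.isSubmodClosed.Build R (nat -> R^o) is_dyadic is_dyadic_submod.

Record dyadic := Dyadic {
  dyadic_fun :> nat -> R^o ;
  _ : dyadic_fun \in is_dyadic
}.

HB.instance Definition _ := [isSub for dyadic_fun].
HB.instance Definition _ := [Choice of dyadic by <:].
HB.instance Definition _ := [SubChoice_isSubLmodule of dyadic by <:].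

Implicit Types f g b : dyadic.

Lemma dyadicP f : exists n, dyadic_period n f.
Proof. exact/is_dyadicP/(valP f). Qed.

Lemma dyadic_ext f g : f =1 g -> f = g.
Proof. by move=> fg; apply/val_inj/funext. Qed.

Lemma dyadic0E k : (0 : dyadic) k = 0. Proof. by []. Qed.
Lemma dyadicDE f g k : (f + g) k = f k + g k. Proof. by []. Qed.
Lemma dyadicNE f k : (- f) k = - f k. Proof. by []. Qed.
Lemma dyadicZE (a : R) f k : (a *: f) k = a * f k. Proof. by []. Qed.

Let join_subproof f g : (fun k => Num.max (f k) (g k) : R^o) \in is_dyadic.
Proof.
apply/is_dyadicP; have [n [fn gn]] := common_period (dyadicP f) (dyadicP g).
by exists n => k; rewrite fn gn.
Qed.

Let join f g := Dyadic (join_subproof f g).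

Let joinC : commutative join.
Proof. by move=> f g; apply: dyadic_ext => k /=; rewrite maxC. Qed.

Let joinA : associative join.
Proof. by move=> f g h; apply: dyadic_ext => k /=; rewrite maxA. Qed.

Let joinxx : idempotent_op join.
Proof. by move=> f; apply: dyadic_ext => k /=; rewrite maxxx. Qed.

Let joinDr h f g : join (f + h) (g + h) = join f g + h.
Proof. by apply: dyadic_ext => k; exact/esym/addr_maxl. Qed.

Let join_scale (a : R) f : 0 <= a -> join 0 (a *: f) = a *: join 0 f.
Proof.
move=> a0; apply: dyadic_ext => k.
by have := maxr_pMr 0 (f k) a0; rewrite mulr0.
Qed.

HB.instance Definition _ := Lmodule_hasJoin.Build R dyadic
  joinC joinA joinxx joinDr join_scale.

Lemma dyadic_joinE f g k : vjoin f g k = Num.max (f k) (g k).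
Proof. by []. Qed.

Lemma dyadic_absE f k : vabs f k = `|f k|.
Proof. by rewrite /vabs dyadic_joinE dyadicNE maxrN. Qed.

Lemma dyadic_leP f g : reflect (forall k, f k <= g k) (f <= g).
Proof.
apply: (iffP (vjoin_idPr _ _)) => [fg k|fg].
  by rewrite -[in leRHS]fg dyadic_joinE le_max lexx.
by apply: dyadic_ext => k; rewrite dyadic_joinE; apply/max_idPr.
Qed.

Definition mean (n : nat) (f : nat -> R) : R :=
  (\sum_(0 <= k < 2 ^ n) `|f k|) / 2 ^+ n.

Lemma mean_period n m (f : nat -> R) : (n <= m)%N -> dyadic_period n f ->
  mean m f = mean n f.
Proof.
move=> nm fn; rewrite -(subnK nm); elim: (m - n)%N => // d <-.
have fd : dyadic_period (d + n)%N f by apply: dyadic_periodW fn; rewrite leq_addl.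
rewrite /mean addSn expnS mul2n -addnn exprS.
rewrite (@big_cat_nat _ _ _ (2 ^ (d + n))) ?leq_addr//=.
rewrite -{2}[(2 ^ _)%N]add0n big_addn addnK.
under [X in _ + X]eq_bigr do rewrite fd.
by rewrite -mulr2n -[_ *+ 2]mulr_natl invfM mulrACA divff ?mul1r.
Qed.

(** The mean of |f| over a period: the value does not depend on the period, see
    [dmeanE], and the default 0 is never reached. It is the integral of |f| for
    the Haar measure of the 2-adic integers. *)
Definition dmean f : R := mean (xget 0%N [set n | dyadic_period n f]) f.

Lemma dmeanE n f : dyadic_period n f -> dmean f = mean n f.
Proof.
move=> fn; rewrite /dmean; set m := xget _ _.
have fm : dyadic_period m f.
  exact: (@xgetPex _ 0%N [set n | dyadic_period n f] (ex_intro _ n fn)).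
by rewrite -(mean_period (leq_maxl n m) fn) -(mean_period (leq_maxr n m) fm).
Qed.

Lemma dmean_le f g : (forall k, `|f k| <= `|g k|) -> dmean f <= dmean g.
Proof.
move=> fg; have [n [fn gn]] := common_period (dyadicP f) (dyadicP g).
rewrite (dmeanE fn) (dmeanE gn) /mean ler_pM2r ?invr_gt0 ?exprn_gt0//.
by apply: ler_sum.
Qed.

Lemma dmeanD f g : dmean (f + g) <= dmean f + dmean g.
Proof.
have [n [fn gn]] := common_period (dyadicP f) (dyadicP g).
have fgn : dyadic_period n (f + g) by move=> k; rewrite !dyadicDE fn gn.
rewrite (dmeanE fn) (dmeanE gn) (dmeanE fgn) /mean -mulrDl.
rewrite ler_pM2r ?invr_gt0 ?exprn_gt0// -big_split/=.
by apply: ler_sum => k _; exact: ler_normD.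
Qed.

Lemma dmeanN f : dmean (- f) = dmean f.
Proof. by apply/le_anti; rewrite !dmean_le// => k; rewrite dyadicNE normrN. Qed.

Lemma dmeanB f g : dmean (f - g) <= dmean f + dmean g.
Proof. by rewrite -(dmeanN g) dmeanD. Qed.

Lemma dmeanZ (a : R) f : dmean (a *: f) = `|a| * dmean f.
Proof.
have [n fn] := dyadicP f.
have an : dyadic_period n (a *: f) by move=> k; rewrite !dyadicZE fn.
rewrite (dmeanE fn) (dmeanE an) /mean mulrA mulr_sumr.
by congr (_ / _); apply: eq_bigr => k _; rewrite dyadicZE normrM.
Qed.

Lemma dmean_le_bound f (c : R) : (forall k, `|f k| <= c) -> dmean f <= c.
Proof.
move=> fc; rewrite /dmean/mean ler_pdivrMr ?exprn_gt0//.
rewrite (@le_trans _ _ (\sum_(0 <= k < 2 ^ xget 0%N [set n | dyadic_period n f]) c))//.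
  exact: ler_sum.
by rewrite sumr_const_nat subn0 -natrX mulr_natr.
Qed.

Lemma dyadic_bounded f : exists c : R, forall k, `|f k| <= c.
Proof.
have [n fn] := dyadicP f.
exists (\sum_(0 <= k < 2 ^ n) `|f k|) => k.
rewrite -(dyadic_period_mod fn) big_mkord.
have kn : (k %% 2 ^ n < 2 ^ n)%N by rewrite ltn_mod expn_gt0.
by rewrite (bigD1 (Ordinal kn))//= lerDl sumr_ge0.
Qed.

Let residue_subproof n r :
  (fun k => (k == r %[mod 2 ^ n])%N%:R : R^o) \in is_dyadic.
Proof. by apply/is_dyadicP; exists n => k; rewrite modnDr. Qed.

Definition residue n r : dyadic := Dyadic (residue_subproof n r).

Lemma residueE n r k : residue n r k = (k == r %[mod 2 ^ n])%N%:R.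
Proof. by []. Qed.

Lemma dmean_residue n r : dmean (residue n r) = 2 ^- n.
Proof.
have rn : dyadic_period n (residue n r) by move=> k; rewrite !residueE modnDr.
rewrite (dmeanE rn) /mean -[RHS]mul1r; congr (_ / _).
have lt_r : (r %% 2 ^ n < 2 ^ n)%N by rewrite ltn_mod expn_gt0.
rewrite big_mkord (bigD1 (Ordinal lt_r))//= modn_mod eqxx normr1.
rewrite big1 ?addr0// => k; rewrite -val_eqE/= => kr.
by rewrite modn_small// (negPf kr) normr0.
Qed.

End DyadicSpace.
Arguments dyadic : clear implicits.

(** * Negligible sets and the topology of the step functions *)

Section DyadicTopology.
Context {R : realType}.
Implicit Types (f g b : dyadic R) (K : set nat).

Lemma exp2N_small (e : R) : 0 < e -> exists n, 2 ^- n <= e.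
Proof.
move=> e0; exists (Num.bound e^-1).
rewrite invf_ple ?posrE ?exprn_gt0//.
rewrite (le_trans (ltW (archi_boundP _))) ?invr_ge0 ?ltW//.
by rewrite -natrX ltr_nat ltn_expl.
Qed.

(** This bounds by e the outer Jordan content of K in the 2-adic integers. Covers
    are functions rather than sets because functions can be added. *)
Definition outer_mean_le (e : R) K :=
  exists b, (forall k, K k -> 1 <= b k) /\ dmean b <= e.

Definition negligible_set K := forall e : R, 0 < e -> outer_mean_le e K.

Lemma outer_mean_leS (e : R) K L : K `<=` L -> outer_mean_le e L -> outer_mean_le e K.
Proof. by move=> KL [b [b1 be]]; exists b; split=> // k /KL/b1. Qed.

Lemma outer_mean_leU (d e : R) K L : outer_mean_le d K -> outer_mean_le e L ->
  outer_mean_le (d + e) (K `|` L).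
Proof.
move=> [b [bK bd]] [c [cL ce]]; exists (vabs b + vabs c); split=> [k KLk|].
  rewrite dyadicDE !dyadic_absE.
  have := ler_norm (b k); have := ler_norm (c k).
  have := normr_ge0 (b k); have := normr_ge0 (c k).
  by case: KLk => [/bK|/cL]; lra.
have mean_abs f : dmean (vabs f) <= dmean f.
  by apply: dmean_le => k; rewrite dyadic_absE normr_id.
by rewrite (le_trans (dmeanD _ _))// lerD// (le_trans (mean_abs _)).
Qed.

Lemma negligible_set0 : negligible_set set0.
Proof.
move=> e e0; exists 0; split=> //.
by apply: (dmean_le_bound (c := e)) => k; rewrite dyadic0E normr0 ltW.
Qed.

Lemma negligible_setS K L : K `<=` L -> negligible_set L -> negligible_set K.
Proof. by move=> KL L0 e /L0; exact: outer_mean_leS. Qed.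

Lemma negligible_setU K L : negligible_set K -> negligible_set L ->
  negligible_set (K `|` L).
Proof.
move=> K0 L0 e e0; have e2 : 0 < e / 2 by rewrite divr_gt0.
by rewrite [e]splitr; apply: outer_mean_leU; [exact: K0|exact: L0].
Qed.

Lemma negligible_set1 k : negligible_set [set k].
Proof.
move=> e /exp2N_small[n ne]; exists (residue n k).
by rewrite dmean_residue; split=> // _ ->; rewrite residueE eqxx.
Qed.

Lemma negligible_initial (y : nat -> nat) m : negligible_set [set y k | k in `I_m].
Proof.
elim: m => [|m IH].
  by apply: (@negligible_setS _ set0) => [_ []//|]; exact: negligible_set0.
apply: negligible_setS (negligible_setU IH (negligible_set1 (y m))).
move=> _ [k /= + <-]; rewrite ltnS leq_eqVlt => /predU1P[->|km]; first by right.
by left; exists k.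
Qed.

(** All but finitely many terms of a 2-adically convergent sequence lie in one
    small residue class, and finite sets are negligible. *)
Lemma negligible_convergent (y : nat -> nat) :
  (forall n, exists m, forall k, (m <= k)%N -> (y k = y m %[mod 2 ^ n])%N) ->
  negligible_set (range y).
Proof.
move=> yc e e0; have e2 : 0 < e / 2 by rewrite divr_gt0.
have [n ne] := exp2N_small e2; have [m ym] := yc n.
apply: (@outer_mean_leS _ _ ([set y k | k in `I_m] `|` y @` [set k | (m <= k)%N])).
  by move=> _ [k _ <-]; case: (leqP m k) => mk; [right|left]; exists k.
rewrite [e]splitr; apply: outer_mean_leU; first exact: negligible_initial.
exists (residue n (y m)); rewrite dmean_residue; split=> // _ [k mk <-].
by rewrite residueE ym ?eqxx.
Qed.

(** The slack d < e makes these sets open although K may be infinite. *)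
Definition dyadic_ball K (e : R) : set (dyadic R) :=
  [set f | exists2 d, d < e & dmean f <= d /\ forall k, K k -> `|f k| <= d].

Lemma dyadic_ballS K L (d e : R) : L `<=` K -> d <= e ->
  dyadic_ball K d `<=` dyadic_ball L e.
Proof.
move=> LK de f [r rd [fr fK]]; exists r; first exact: lt_le_trans de.
by split=> // k /LK/fK.
Qed.

Lemma dyadic_ball_le K (d e : R) f : d < e -> dmean f <= d ->
  (forall k, K k -> `|f k| <= d) -> dyadic_ball K e f.
Proof. by move=> de fd fK; exists d. Qed.

Lemma dyadic_ball_val K (e : R) f k : dyadic_ball K e f -> K k -> `|f k| < e.
Proof. by move=> [d de [_ fK]] /fK/le_lt_trans; exact. Qed.

Lemma dyadic_ball_mean K (e : R) f : dyadic_ball K e f -> dmean f < e.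
Proof. by move=> [d de [fd _]]; exact: le_lt_trans de. Qed.

Lemma dyadic_ballD K (d e : R) f g : dyadic_ball K d f -> dyadic_ball K e g ->
  dyadic_ball K (d + e) (f + g).
Proof.
move=> [r rd [fr fK]] [s se [gs gK]]; exists (r + s); first exact: ltrD.
split=> [|k Kk]; first by rewrite (le_trans (dmeanD _ _))// lerD.
by rewrite dyadicDE (le_trans (ler_normD _ _))// lerD ?fK ?gK.
Qed.

Let ball_base : set_system (dyadic R) :=
  [set A | exists K (e : R), [/\ negligible_set K, 0 < e & A = dyadic_ball K e]].

Let ball_baseT : exists A, ball_base A.
Proof. by exists (dyadic_ball set0 1), set0, 1; split=> //; exact: negligible_set0. Qed.

Let ball_baseI A B : ball_base A -> ball_base B ->
  exists2 C, ball_base C & C `<=` A `&` B.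
Proof.
move=> [K [d [K0 d0 ->]]] [L [e [L0 e0 ->]]].
exists (dyadic_ball (K `|` L) (Num.min d e)).
  exists (K `|` L), (Num.min d e); split=> //; first exact: negligible_setU.
  by rewrite lt_min d0.
by move=> f fKL; split; apply: dyadic_ballS fKL;
  by [move=> k ?; left|move=> k ?; right|rewrite ge_min lexx ?orbT].
Qed.

Let ball_base_solid A : ball_base A -> solid A.
Proof.
move=> [K [e [_ _ ->]]] f g fg [d de [gd gK]].
have fgk k : `|f k| <= `|g k| by rewrite -!dyadic_absE; exact/dyadic_leP.
exists d => //; split=> [|k /gK]; last exact: le_trans.
by apply: le_trans gd; exact: dmean_le.
Qed.

Let ball_baseD A : ball_base A ->
  exists2 B, ball_base B & forall f g, B f -> B g -> A (f + g).
Proof.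
move=> [K [e [K0 e0 ->]]]; exists (dyadic_ball K (e / 2)).
  by exists K, (e / 2); split=> //; rewrite divr_gt0.
by move=> f g fK gK; rewrite [e]splitr; exact: dyadic_ballD.
Qed.

Let ball_base_absorb A f : ball_base A -> exists2 a : R, 0 < a & A (a *: f).
Proof.
move=> [K [e [K0 e0 ->]]]; have [c fc] := dyadic_bounded f.
have c0 : 0 <= c := le_trans (normr_ge0 _) (fc 0%N).
have c1 : 0 < 1 + c by rewrite ltr_pwDl.
have a0 : 0 < e / 2 / (1 + c) by rewrite !divr_gt0.
have small k : `|(e / 2 / (1 + c) *: f) k| <= e / 2.
  rewrite dyadicZE normrM gtr0_norm// mulrAC ler_pdivrMr//.
  by rewrite ler_pM2l ?divr_gt0// (le_trans (fc k))// lerDr.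
exists (e / 2 / (1 + c)) => //; apply: (@dyadic_ball_le _ (e / 2)) => //; first lra.
exact: dmean_le_bound.
Qed.

HB.instance Definition _ := VectorLattice_hasSolidBase.Build R (dyadic R)
  ball_baseT ball_baseI ball_base_solid ball_baseD ball_base_absorb.

Lemma dyadic_ball_nbhs K (e : R) : negligible_set K -> 0 < e ->
  nbhs 0 (dyadic_ball K e).
Proof.
move=> K0 e0; exists (dyadic_ball K e); first by exists K, e.
by move=> f; rewrite add0r.
Qed.

Lemma dyadic_ball_basis (A : set (dyadic R)) : nbhs 0 A ->
  exists K (e : R), [/\ negligible_set K, 0 < e & dyadic_ball K e `<=` A].
Proof.
move=> [_ [K [e [K0 e0 ->]]] KA]; exists K, e; split=> // f /KA.
by rewrite add0r.
Qed.

Lemma dyadic_hausdorff : hausdorff_space (dyadic R).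
Proof.
apply/hausdorff_zeroP => f fU; apply: dyadic_ext => k; rewrite dyadic0E.
apply/eqP; rewrite -normr_le0; apply/ler_addgt0Pl => e e0; rewrite addr0.
have := fU _ (dyadic_ball_nbhs (negligible_set1 k) e0).
by move=> /dyadic_ball_val/(_ erefl)/ltW.
Qed.

Lemma dyadic_ball_convex K (e : R) (f0 : dyadic R) :
  convex_set [set f | dyadic_ball K e (f - f0)].
Proof.
move=> f g t; rewrite !inE /= => -[r re [fr fK]] [s se [gs gK]].
have t0 : 0 <= t%:num by []. have t1 : 0 <= 1 - t%:num by rewrite subr_ge0.
have convm (p q : R) : p <= r -> q <= s ->
    t%:num * p + (1 - t%:num) * q <= Num.max r s.
  move=> pr qs; have pm : p <= Num.max r s by rewrite le_max pr.
  have qm : q <= Num.max r s by rewrite le_max qs orbT.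
  rewrite (le_trans (lerD (ler_wpM2l t0 pm) (ler_wpM2l t1 qm)))//.
  by rewrite -mulrDl addrC subrK mul1r.
change (dyadic_ball K e (t%:num *: f + (1 - t%:num) *: g - f0)).
have -> : t%:num *: f + (1 - t%:num) *: g - f0 =
    t%:num *: (f - f0) + (1 - t%:num) *: (g - f0).
  by rewrite !scalerBr addrACA -opprD -scalerDl [t%:num + _]addrC subrK scale1r.
exists (Num.max r s); first by rewrite gt_max re.
split=> [|k Kk].
  rewrite (le_trans (dmeanD _ _))// !dmeanZ (ger0_norm t0) (ger0_norm t1).
  exact: convm.
rewrite dyadicDE (le_trans (ler_normD _ _))// !dyadicZE !normrM.
by rewrite (ger0_norm t0) (ger0_norm t1); apply: convm; [exact: fK|exact: gK].
Qed.

Lemma dyadic_ball_open K (e : R) f0 : negligible_set K ->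
  open [set f | dyadic_ball K e (f - f0)].
Proof.
move=> K0; rewrite openE => f [d de [fd fK]]; apply/nbhs_zeroE.
have ed0 : 0 < e - d by rewrite subr_gt0.
apply: filterS (dyadic_ball_nbhs K0 ed0) => g [r rd [gr gK]] /=.
exists (d + r); first by rewrite addrC -ltrBrDr.
rewrite addrAC; split=> [|k Kk]; first by rewrite (le_trans (dmeanD _ _))// lerD.
by rewrite dyadicDE (le_trans (ler_normD _ _))// lerD// ?fK ?gK.
Qed.

Lemma dyadic_locally_convex : locally_convex_space (dyadic R).
Proof.
exists [set U | exists K (e : R) f0, [/\ negligible_set K, 0 < e &
    U = [set f | dyadic_ball K e (f - f0)]]].
  by move=> U; rewrite inE => -[K [e [f0 [K0 e0 ->]]]]; exact: dyadic_ball_convex.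
split=> [_ [K [e [f0 [K0 e0 ->]]]]|f A]; first exact: dyadic_ball_open.
move=> /nbhs_zeroE/dyadic_ball_basis[K [e [K0 e0 KA]]].
exists [set g | dyadic_ball K e (g - f)].
  split; first by exists K, e, f.
  by rewrite /= subrr; apply: nbhs_singleton; exact: dyadic_ball_nbhs.
by move=> g /KA/=; rewrite addrC subrK.
Qed.

End DyadicTopology.

(** * The generalized (A, 0) property *)

Lemma eqmod_pow2S n k r : (k = r %[mod 2 ^ n])%N ->
  (k = r %[mod 2 ^ n.+1])%N \/ (k = r + 2 ^ n %[mod 2 ^ n.+1])%N.
Proof.
have N0 : (0 < 2 ^ n)%N by rewrite expn_gt0.
rewrite expnS mul2n -addnn; move: (2 ^ n)%N N0 => N N0 kr.
have modE m : (m %% (N + N) = odd (m %/ N) * N + m %% N)%N.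
  rewrite {1}(divn_eq m N) -{1}(odd_double_half (m %/ N)) mulnDl -addnA addnCA.
  rewrite -muln2 -mulnA mul2n -addnn modnMDl modn_small//.
  by have := ltn_pmod m N0; case: odd => /=; lia.
rewrite !modE kr modnDr divnDr ?dvdnn// divnn N0 oddD /=.
by case: (odd (k %/ N)); case: (odd (r %/ N)); [left|right|right|left].
Qed.

Section CauchyDecreasing.
Context {R : realType} {I : directedSet} (x : I -> dyadic R).
Hypothesis xC : cauchy_net x.
Hypothesis x_decr : forall i j, dle i j -> x j <= x i.

Lemma cauchy_uniform (K : set nat) (e : R) : negligible_set (R := R) K -> 0 < e ->
  exists i0, forall i k, dle i0 i -> K k -> `|x i0 k - x i k| < e.
Proof.
move=> K0 e0; have [i0 xi0] := xC (dyadic_ball_nbhs K0 e0).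
exists i0 => i k i0i Kk; have := xi0 i0 i (dle_refl _) i0i.
by move=> /dyadic_ball_val/(_ Kk).
Qed.

(** The limit of the net is continuous for the 2-adic topology, because the
    convergence is uniform on the range of a convergent sequence. Were it
    positive at k, it would exceed some e / 2 > 0 on a whole residue class of k,
    and e / 2 times the indicator of that class would be a nonzero lower bound
    of the net in X. *)
Lemma decreasing_pointwise_zero : (forall i, 0 <= x i) -> infimums (range x) 0 ->
  forall (k : nat) (e : R), 0 < e -> exists i, x i k < e.
Proof.
move=> x0 [_ xinf] k e e0; apply: contrapT => /forallNP xk.
have {}xk i : e <= x i k by rewrite leNgt; apply/negP.
have [n xn] : exists n, forall i j, (j = k %[mod 2 ^ n])%N -> e / 2 <= x i j.
  apply: contrapT => /forallNP noclass.
  have /choice[p pP] : forall n, exists p : I * nat,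
      (p.2 = k %[mod 2 ^ n])%N /\ x p.1 p.2 < e / 2.
    move=> n; have /existsNP[i /existsNP[j /not_implyP[jk]]] := noclass n.
    by move=> /negP; rewrite -ltNge => xij; exists (i, j).
  (* y n converges to k, while the net drops below e / 2 at each y n *)
  pose y n := (p n).2.
  have yc : negligible_set (R := R) (range y).
    apply: negligible_convergent => n; exists n => m nm.
    have ynm l : (n <= l)%N -> (y l = k %[mod 2 ^ n])%N.
      move=> nl; have [yk _] := pP l.
      by rewrite -(modn_dvdm (y l) (dvdn_exp2l 2 nl)) yk modn_dvdm ?dvdn_exp2l.
    by rewrite !ynm.
  have [i0 xi0] := cauchy_uniform yc (divr_gt0 e0 (ltr0n _ 4)).
  have [n xn] := dyadicP (x i0); have [yk xy] := pP n.
  have [j [i0j nj]] := dle_directed i0 (p n).1.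
  have := xi0 j (y n) i0j (imageT _ n).
  rewrite (dyadic_period_eqmod xn yk).
  have /dyadic_leP/(_ (y n)) := x_decr nj; have := xk i0.
  have := ler_norm (x i0 k - x j (y n)).
  by rewrite /y; lra.
have : (e / 2) *: residue n k <= 0.
  apply: xinf => _ [i _ <-]; apply/dyadic_leP => j.
  rewrite dyadicZE residueE; case: eqP => jk; first by rewrite mulr1 xn.
  by rewrite mulr0; have /dyadic_leP := x0 i; exact.
by move=> /dyadic_leP/(_ k); rewrite dyadicZE residueE eqxx dyadic0E mulr1; lra.
Qed.

(** Dini's theorem on the compact group of 2-adic integers. If the values of the
    net keep exceeding e, then they do so on nested residue classes, whose
    representatives r n converge to a 2-adic integer. By periodicity one function
    of the net is at least e at r n for n large, whereas uniformity along r and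
    the pointwise limit 0 make it smaller. *)
Lemma decreasing_uniform_zero :
  (forall (k : nat) (e : R), 0 < e -> exists i, x i k < e) ->
  forall e : R, 0 < e -> exists i, forall k, x i k < e.
Proof.
move=> xk e e0; apply: contrapT => /forallNP xe.
pose heavy n r := forall i, exists2 k, (k = r %[mod 2 ^ n])%N & e <= x i k.
have heavy0 : heavy 0%N 0%N.
  move=> i; have /existsNP[k /negP] := xe i; rewrite -leNgt => ek.
  by exists k => //; rewrite !modn1.
have heavyS n r : heavy n r -> exists s, (s = r %[mod 2 ^ n])%N /\ heavy n.+1 s.
  move=> hr; apply: contrapT => /forallNP no.
  have /not_andP[//|/existsNP[i1 h1]] := no r.
  have /not_andP[|/existsNP[i2 h2]] := no (r + 2 ^ n)%N.
    by rewrite modnDr.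
  have [j [i1j i2j]] := dle_directed i1 i2; have [k kr ek] := hr j.
  have eki i : dle i j -> e <= x i k.
    by move=> ij; apply: le_trans ek _; have /dyadic_leP := x_decr ij; exact.
  have [kmod|kmod] := eqmod_pow2S kr.
    by apply: h1; exists k => //; exact: eki.
  by apply: h2; exists k => //; exact: eki.
have /choice[s sP] : forall p : nat * nat, exists s, heavy p.1 p.2 ->
    (s = p.2 %[mod 2 ^ p.1])%N /\ heavy p.1.+1 s.
  move=> p; have [/heavyS[s sp]|nh] := pselect (heavy p.1 p.2); first by exists s.
  by exists 0%N.
pose r := fix r n := if n is m.+1 then s (m, r m) else 0%N.
have hr n : heavy n (r n) by elim: n => // n /(sP (n, r n))[].
have rc n m : (n <= m)%N -> (r m = r n %[mod 2 ^ n])%N.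
  move=> nm; rewrite -(subnK nm); elim: (m - n)%N => // d <-.
  have [rr _] := sP (d + n, r (d + n))%N (hr _); rewrite addSn.
  have dv : (2 ^ n %| 2 ^ (d + n))%N by rewrite dvdn_exp2l// leq_addl.
  by rewrite -(modn_dvdm _ dv) rr modn_dvdm.
have rnull : negligible_set (R := R) (range r).
  by apply: negligible_convergent => n; exists n => k /rc.
have [i0 xi0] := cauchy_uniform rnull (divr_gt0 e0 (ltr0n _ 4)).
have [n xn] := dyadicP (x i0).
have [k kr ek] := hr n i0; rewrite (dyadic_period_eqmod xn kr) in ek.
have [i xi] := xk (r n) _ (divr_gt0 e0 (ltr0n _ 2)).
have [j [i0j ij]] := dle_directed i0 i.
have := xi0 j (r n) i0j (imageT _ n).
have /dyadic_leP/(_ (r n)) := x_decr ij.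
by have := ler_norm (x i0 (r n) - x j (r n)); lra.
Qed.

End CauchyDecreasing.

Theorem dyadic_A0 (R : realType) : generalized_A0 (dyadic R).
Proof.
move=> I x x0 xC [x_decr xinf]; apply/net_cvgP => U /dyadic_ball_basis.
move=> [K [e [K0 e0 KU]]]; have e2 : 0 < e / 2 by rewrite divr_gt0.
have xk := decreasing_pointwise_zero xC x_decr x0 xinf.
have [i xi] := decreasing_uniform_zero xC x_decr xk e2.
exists i => j ij; apply: KU; rewrite subr0.
have xj k : `|x j k| <= e / 2.
  have /dyadic_leP/(_ k) := x0 j; rewrite dyadic0E => xj0; rewrite ger0_norm//.
  by rewrite (le_trans _ (ltW (xi k)))//; have /dyadic_leP := x_decr _ _ ij; exact.
apply: (@dyadic_ball_le _ _ (e / 2)) => //; first lra.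
exact: dmean_le_bound.
Qed.

(** * A decreasing sequence with positive means *)

Section Punctured.
Context {R : realType}.

(** Indicator of the set obtained from nat by removing, for each m < n, the class
    of m modulo 2 ^ (m + 2). In the limit every natural number is removed, but
    the removed classes have total mean at most 1/4 + 1/8 + ... = 1/2: in the
    2-adic integers there remains a closed set of positive measure with empty
    interior. *)
Fixpoint punctured (n : nat) : dyadic R :=
  if n is m.+1 then vjoin (punctured m - residue m.+2 m) 0 else residue 0 0.

Lemma puncturedSE n k :
  punctured n.+1 k = Num.max (punctured n k - residue n.+2 n k) 0.
Proof. by []. Qed.

Lemma residue_itv n r k : 0 <= (residue n r : dyadic R) k <= 1.
Proof. by rewrite residueE; case: eqP; rewrite ?lexx ?ler01. Qed.

Lemma punctured_itv n k : 0 <= punctured n k <= 1.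
Proof.
elim: n => [|n /andP[n0 n1]]; first exact: residue_itv.
rewrite puncturedSE le_max lexx orbT ge_max ler01 andbT/= lerBlDr.
by rewrite (le_trans n1)// lerDl; have /andP[] := residue_itv n.+2 n k.
Qed.

Lemma punctured_nonincr n m : (n <= m)%N -> punctured m <= punctured n.
Proof.
move=> /subnK<-; elim: (m - n)%N => // d; apply: le_trans; apply/dyadic_leP => k.
rewrite addSn puncturedSE ge_max lerBlDr lerDl.
by have /andP[-> _] := residue_itv (d + n).+2 (d + n) k;
  have /andP[-> _] := punctured_itv (d + n) k.
Qed.

Lemma punctured_self n : punctured n.+1 n = 0.
Proof.
rewrite puncturedSE residueE eqxx mulr1n; apply/max_idPr; rewrite subr_le0.
by have /andP[] := punctured_itv n n.
Qed.

(** The right-hand side is the geometric sum of the means 2 ^- (m + 2) of the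
    classes removed for n <= m < n + d. *)
Lemma dmean_punctured_step n d :
  dmean (punctured n - punctured (n + d)) <= 2 ^- n.+1 - 2 ^- (n + d).+1.
Proof.
elim: d => [|d IH].
  rewrite addn0 !subrr; apply: dmean_le_bound => k.
  by rewrite dyadic0E normr0.
rewrite -(subrKA (punctured (n + d))) (le_trans (dmeanD _ _))//.
have step : dmean (punctured (n + d) - punctured (n + d.+1)) <= 2 ^- (n + d).+2.
  rewrite -(dmean_residue (n + d).+2 (n + d)); apply: dmean_le => k.
  rewrite dyadicDE dyadicNE addnS puncturedSE.
  have /andP[] := residue_itv (n + d).+2 (n + d) k.
  have /andP[] := punctured_itv (n + d) k.
  move: (punctured _ k) (residue _ _ k) => a b a0 a1 b0 b1.
  by rewrite (ger0_norm b0) /Num.max; case: ifPn; rewrite -?leNgt => ab;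
    rewrite ler_norml; lra.
apply: (le_trans (lerD IH step)); rewrite addnS !exprS !invfM.
by move: (2 ^+ n)^-1 (2 ^+ (n + d))^-1 => a b; lra.
Qed.

Lemma dmean_punctured_diff n m : (n <= m)%N ->
  dmean (punctured n - punctured m) <= 2 ^- n.+1.
Proof.
move=> /subnKC<-; rewrite (le_trans (dmean_punctured_step _ _))//.
by rewrite gerBl invr_ge0 exprn_ge0.
Qed.

Lemma dmean_punctured_ge n : 2^-1 <= dmean (punctured n).
Proof.
have := dmeanD (punctured 0 - punctured n) (punctured n).
have := dmean_punctured_diff (leq0n n).
by rewrite subrK expr1 [punctured 0]/= dmean_residue expr0; lra.
Qed.

(** The net approximates the indicator of the remaining closed set in mean, and 0
    uniformly on every negligible set. It is indexed by the precision n and the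
    negligible set K: its term is [punctured n] minus a cover b of K of mean at
    most 2 ^- n, cut at 0. The cut removes K entirely, since [punctured n] is at
    most 1, but changes the mean by at most 2 ^- n. *)
Lemma cauchy_net_below_punctured : exists (I : directedSet) (h : I -> dyadic R),
  [/\ cauchy_net h, forall i, 0 <= h i,
      forall n, eventually_in (fun i => h i <= punctured n) & ~ null_net h].
Proof.
pose T := (nat * {K : set nat | negligible_set (R := R) K})%type.
pose later (i j : T) := (i.1 <= j.1)%N /\ sval i.2 `<=` sval j.2.
have later_refl i : later i i by split.
have later_trans j i k : later i j -> later j k -> later i k.
  by move=> [ij ij2] [jk jk2]; split; [exact: leq_trans jk|exact: subset_trans jk2].
have later_dir i j : exists k, later i k /\ later j k.
  case: i j => [n [K K0]] [m [L L0]].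
  exists (maxn n m, exist _ _ (negligible_setU K0 L0)).
  split; split=> /=; [exact: leq_maxl|by move=> k; left|exact: leq_maxr|].
  by move=> k; right.
have inh : inhabited T by constructor; exact: (0%N, exist _ _ negligible_set0).
pose I := DirectedSet later_refl later_trans later_dir inh.
have /choice[b bP] : forall i : I, exists b : dyadic R,
    (forall k, sval i.2 k -> 1 <= b k) /\ dmean b <= 2 ^- i.1.
  by move=> [n [K K0]]; apply: (K0 (2 ^- n)); rewrite invr_gt0 exprn_gt0.
pose h (i : I) := vjoin (punctured i.1 - vabs (b i)) 0.
have hE i k : h i k = Num.max (punctured i.1 k - `|b i k|) 0.
  by rewrite dyadic_joinE dyadicDE dyadicNE dyadic_absE.
have h0 i : 0 <= h i by exact: vle_joinr.
have hp i : h i <= punctured i.1.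
  apply/dyadic_leP => k; rewrite hE ge_max lerBlDr lerDl normr_ge0.
  by have /andP[] := punctured_itv i.1 k.
have hd i : dmean (h i - punctured i.1) <= 2 ^- i.1.
  apply: le_trans (bP i).2; apply: dmean_le => k.
  rewrite dyadicDE dyadicNE hE; have /andP[] := punctured_itv i.1 k.
  have := normr_ge0 (b i k); move: (punctured _ k) `|b i k| => a c c0 a0 a1.
  by rewrite /Num.max; case: ifPn; rewrite -?leNgt => ac; rewrite ler_norml; lra.
have hK i k : sval i.2 k -> h i k = 0.
  move=> /((bP i).1) b1; rewrite hE; apply/max_idPr; rewrite subr_le0.
  have /andP[_ p1] := punctured_itv i.1 k.
  by apply: (le_trans p1); apply: (le_trans b1); exact: ler_norm.
exists I, h; split=> //.
- move=> U /dyadic_ball_basis[K [e [K0 e0 KU]]].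
  have [n ne] := exp2N_small (divr_gt0 e0 (ltr0n R 8)).
  have near i : (n <= i.1)%N -> dmean (h i - punctured n) <= 2 ^- n + 2 ^- n.
    move=> ni; rewrite -(subrKA (punctured i.1)).
    apply: le_trans (dmeanD _ _) _.
    have -> : punctured i.1 - punctured n = - (punctured n - punctured i.1).
      by rewrite opprB.
    rewrite dmeanN; apply: lerD.
      apply: le_trans (hd i) _.
      by rewrite lef_pV2 ?posrE ?exprn_gt0// ler_weXn2l// ler1n.
    apply: le_trans (dmean_punctured_diff ni) _.
    by rewrite lef_pV2 ?posrE ?exprn_gt0// ler_weXn2l// ler1n.
  exists ((n, exist _ K K0) : I) => i j [ni Ki] [nj Kj]; apply: KU.
  apply: (@dyadic_ball_le _ _ (e / 2)); first by lra.
    rewrite -(subrKA (punctured n)) -[punctured n - h j]opprB.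
    apply: le_trans (dmeanB _ _) _.
    apply: le_trans (lerD (near _ ni) (near _ nj)) _.
    by move: ne; move: (2 ^- n) => a; lra.
  move=> k Kk; rewrite dyadicDE dyadicNE !hK ?subrr ?normr0;
    [lra|exact: Kj|exact: Ki].
- move=> n; exists ((n, exist _ _ negligible_set0) : I) => i [/= ni _].
  by apply: le_trans (hp i) (punctured_nonincr ni).
- have e8 : 0 < 8^-1 :> R by lra.
  move=> /(_ _ (dyadic_ball_nbhs negligible_set0 e8))[i0 hi0].
  have [i [i0i [/= i2 _]]] := later_dir i0 (2%N, exist _ _ negligible_set0).
  have /dyadic_ball_mean hi := hi0 i i0i.
  have := dmean_punctured_ge i.1; have := hd i.
  have := dmeanB (h i) (h i - punctured i.1); rewrite subKr.
  have : 2 ^- i.1 <= 2 ^- 2 :> R.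
    by rewrite lef_pV2 ?posrE ?exprn_gt0// ler_weXn2l// ler1n.
  by rewrite (_ : 2 ^- 2 = 4^-1 :> R) ?expr2 -?natrM//; lra.
Qed.

End Punctured.

(** * Order and convergence in an arbitrary completion *)

(** The failure of regularity has to hold in every completion, so the lemmas of
    this part rest on the defining clauses of a completion alone. *)
Section CompletionTheory.
Context {R : realType} {X Xh : locallySolidType R} (J : {linear X -> Xh}).
Hypothesis JC : is_completion J.

Lemma completion_map_inj : injective J.
Proof. exact: (completion_embedding JC).1. Qed.

Lemma completion_map_nbhs (A : set Xh) : nbhs 0 A -> nbhs 0 (J @^-1` A).
Proof.
move=> A0; have Ji : open (J @^-1` A^°).
  by apply/(completion_embedding JC).2; exists A^° => //; exact: open_interior.
apply: (filterS (P := J @^-1` A^°)); first by move=> x; exact: interior_subset.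
by apply: open_nbhs_nbhs; split=> //=; rewrite raddf0.
Qed.

Lemma completion_map_nbhs_inv (U : set X) : nbhs 0 U ->
  exists2 A : set Xh, nbhs 0 A & J @^-1` A `<=` U.
Proof.
move=> U0; have [A Ao AU] := ((completion_embedding JC).2 U^°).1 (open_interior U).
exists A; last by rewrite AU; exact: interior_subset.
apply: open_nbhs_nbhs; split=> //; rewrite -(raddf0 J).
by have : (U^°) 0 by []; rewrite -AU.
Qed.

Lemma completion_map_le x y : (J x <= J y) = (x <= y).
Proof.
apply/vjoin_idPr/vjoin_idPr => [|<-]; rewrite -(completion_join JC).
  exact: completion_map_inj.
by rewrite vjoinA vjoinxx.
Qed.

Lemma completion_map_cauchy (I : directedSet) (x : I -> X) :
  cauchy_net x -> cauchy_net (J \o x).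
Proof.
move=> xC A /completion_map_nbhs/xC[i0 xi]; exists i0 => i j i0i i0j /=.
by rewrite -raddfB; exact: xi.
Qed.

Lemma completion_limit_le (I : directedSet) (x : I -> X) (l : Xh) (y : X) :
  J \o x @ tails I --> l -> eventually_in (fun i => x i <= y) -> l <= J y.
Proof.
move=> /net_cvgP xl [i0 xy]; rewrite -vsub_ge0.
suff : [set z : Xh | 0 <= z] (J y - l) by [].
rewrite (completion_cone JC) => A /nbhs_zeroE/locally_solid[S [S0 sS SA]].
have [i1 xS] := xl _ S0; have [i [i0i i1i]] := dle_directed i0 i1.
exists (J (y - x i)); split; first by exists (y - x i) => //=; rewrite vsub_ge0 xy.
have /SA/= := solidN sS (xS _ i1i); rewrite opprB /=.
by rewrite addrA subrK -raddfB.
Qed.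

Lemma completion_limit_ge0 (I : directedSet) (x : I -> X) (l : Xh) :
  J \o x @ tails I --> l -> (forall i, 0 <= x i) -> 0 <= l.
Proof.
move=> /net_cvgP xl x0.
have : (J \o (fun i => - x i)) @ tails I --> - l.
  apply/net_cvgP => U /locally_solid[S [S0 sS SU]].
  have [i0 xS] := xl _ S0; exists i0 => i /xS /(solidN sS)/SU /=.
  by rewrite raddfN opprB opprK addrC.
move=> Nl; rewrite -vleN2 oppr0 -(raddf0 J); apply: completion_limit_le Nl _.
by have [i] := d_inhabited I; exists i => j _; rewrite -oppr0 vleN2.
Qed.

End CompletionTheory.

(** * Failure of regularity *)

(** The limit l of [cauchy_net_below_punctured] in the completion lies below the
    image of each [punctured n], whose infimum in X is 0. Regularity would give l <= 0, hence
    l = 0, and the net would be null in X. *)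
Theorem dyadic_not_regular (R : realType) (Xh : locallySolidType R)
    (J : {linear dyadic R -> Xh}) :
  is_completion J -> ~ regular_sublattice (range J).
Proof.
move=> JC [_ reg]; have [I [h [hC h0 hp hN]]] := @cauchy_net_below_punctured R.
have [l hl] := completion_complete JC (completion_map_cauchy JC hC).
pose A := range (J \o @punctured R).
have A0 : A !=set0 by exists (J (punctured 0)), 0%N.
have AJ : A `<=` range J by move=> _ [n _ <-]; exists (punctured n).
have inf0 : infimums_in (range J) A 0.
  split; first by exists 0 => //; rewrite raddf0.
    move=> _ [n _ <-]; rewrite -(raddf0 J) completion_map_le//.
    by apply/dyadic_leP => k; have /andP[] := @punctured_itv R n k.
  move=> _ [x _ <-] xA; rewrite -(raddf0 J) completion_map_le//.
  apply/dyadic_leP => n; rewrite dyadic0E -(punctured_self n).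
  have : J x <= J (punctured n.+1) by apply: xA; exists n.+1.
  by rewrite completion_map_le// => /dyadic_leP; exact.
have [_ ub] := (reg A A0 AJ).2 _ inf0.
have l0 : l = 0.
  apply/le_anti; rewrite (completion_limit_ge0 JC hl h0) andbT; apply: ub.
  by move=> _ [n _ <-]; exact: (completion_limit_le JC hl).
apply: hN => U /(completion_map_nbhs_inv JC)[V V0 VU].
have [i hi] := (net_cvgP _ _).1 hl _ V0; exists i => j /hi /=.
by rewrite l0 subr0 => /VU.
Qed.

Theorem theorem5p4 (R : realType) :
  exists X : locallySolidType R,
    [/\ hausdorff_space X,
        locally_convex_space X,
        generalized_A0 X,
        exists (Xh : locallySolidType R) (J : {linear X -> Xh}),
          is_completion J
      & forall (Xh : locallySolidType R) (J : {linear X -> Xh}),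
          is_completion J -> ~ regular_sublattice (range J)].
Proof.
exists (dyadic R); split.
- exact: dyadic_hausdorff.
- exact: dyadic_locally_convex.
- exact: dyadic_A0.
- by eexists; eexists; apply: completion_exists; exact: dyadic_hausdorff.
- exact: dyadic_not_regular.
Qed.
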